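(* Let $P_i\subset\mathbb{E}_i$, $i=1,2$, be $0$-symmetric convex bodies in Euclidean spaces. Then $$K_G^{-1}\,P_1\otimes_{\omega_2}P_2\subset P_1\otimes_{\pi^{inj}}P_2\subset P_1\otimes_{\omega_2}P_2.$$
   Context: All spaces are real. A Euclidean space is a finite dimensional real inner product space; $\mathbb{E}_i,\mathbb{F}_i$ denote Euclidean spaces. $\mathbb{E}_1\otimes\mathbb{E}_2$ carries the scalar product determined by $\langle x^1\otimes x^2,y^1\otimes y^2\rangle_H=\langle x^1,y^1\rangle\langle x^2,y^2\rangle$. A convex body is a compact convex set with nonempty interior; it is $0$-symmetric if $P=-P$. The polar of $C$ is $C^\circ=\{y:\sup_{x\in C}\langle x,y\rangle\le1\}$ (with respect to $\langle\cdot,\cdot\rangle_H$ in tensor product spaces). $g_P(x)=\inf\{\lambda>0:\lambda^{-1}x\in P\}$, so $(\mathbb{E},g_P)$ is the normed space with closed unit ball $P$. For convex bodies $P_i\subset\mathbb{E}_i$ with $0$ in the interior, $P_1\otimes_\pi P_2:=\mathrm{conv}\{x^1\otimes x^2:x^i\in P_i\}$ and $P_1\otimes_\epsilon P_2:=(P_1^\circ\otimes_\pi P_2^\circ)^\circ$. A tensor product $\otimes_\alpha$ of order $2$ of $0$-symmetric convex bodies assigns to each pair of $0$-symmetric convex bodies $P_i\subset\mathbb{E}_i$ a $0$-symmetric convex body $P_1\otimes_\alpha P_2\subset\mathbb{E}_1\otimes\mathbb{E}_2$ such that (1) $P_1\otimes_\pi P_2\subseteq P_1\otimes_\alpha P_2\subseteq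 P_1\otimes_\epsilon P_2$; (2) for all linear $T_i:\mathbb{E}_i\to\mathbb{F}_i$ and $0$-symmetric convex bodies $Q_i\subset\mathbb{F}_i$ with $T_i(P_i)\subseteq Q_i$, $T_1\otimes T_2(P_1\otimes_\alpha P_2)\subseteq Q_1\otimes_\alpha Q_2$. It is injective if $(P_1\cap M_1)\otimes_\alpha(P_2\cap M_2)=(P_1\otimes_\alpha P_2)\cap(M_1\otimes M_2)$ for all $0$-symmetric convex bodies $P_i\subset\mathbb{E}_i$ and subspaces $M_i\subseteq\mathbb{E}_i$ (with the induced scalar product). Write $\otimes_\alpha\subseteq\otimes_\beta$ if $P_1\otimes_\alpha P_2\subseteq P_1\otimes_\beta P_2$ for all pairs. Then $P_1\otimes_{\pi^{inj}}P_2:=\bigcap\{P_1\otimes_\beta P_2:\otimes_\beta\text{ injective},\ \otimes_\pi\subseteq\otimes_\beta\}$. Hilbertian tensor norm: for finite dimensional normed spaces $M,N$ and $u=\sum_k x_k\otimes y_k\in M\otimes N$, let $T_u:M^*\to N$, $T_u(x^* )=\sum_k x^*(x_k)y_k$, and $\omega_2(u):=\inf\{\|R\|\|S\|\}$ over all factorizations $T_u=RS$ of $T_u$ through a Hilbert space. The Hilbertian tensor product of $0$-symmetric convex bodies is $P_1\otimes_{\omega_2}P_2:=\{z\in\mathbb{E}_1\otimes\mathbb{E}_2:\omega_2(z)\le1\}$, with $\omega_2$ computed on $(\mathbb{E}_1,g_{P_1})\otimes(\mathbb{E}_2,g_{P_2})$. $K_G$ is the (real) Grothendieck constant, i.e.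 the least constant such that $\pi(u)\le K_G\,\omega_2(u)$ for all $u\in\ell_\infty^m\otimes\ell_\infty^n$ and all $m,n\in\mathbb{N}$, where $\pi(u)=\inf\{\sum_k\|x_k\|\|y_k\|:u=\sum_k x_k\otimes y_k\}$. *)

(* Defs.v *)
From HB Require Import structures.
From mathcomp Require Import all_boot all_order all_algebra.
From mathcomp Require Import all_classical all_reals all_analysis.
From mathcomp Require Import ring lra.

Set Implicit Arguments.
Unset Strict Implicit.
Unset Printing Implicit Defensive.

Import Order.TTheory GRing.Theory Num.Theory.
Import numFieldNormedType.Exports.

Local Open Scope classical_set_scope.
Local Open Scope ring_scope.


HB.mixin Record NormedModule_hasInner (R : realType) V & NormedModule R V := {
  inner : V -> V -> R;
  innerC : forall x y, inner x y = inner y x;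
  innerDl : forall x y z, inner (x + y) z = inner x z + inner y z;
  innerZl : forall a x y, inner (a *: x) y = a * inner x y;
  inner_normr : forall x, inner x x = `|x| ^+ 2
}.

#[short(type="innerModType")]
HB.structure Definition InnerModule (R : realType) :=
  {V of NormedModule R V & NormedModule_hasInner R V}.

#[short(type="euclidType")]
HB.structure Definition Euclid (R : realType) :=
  {V of InnerModule R V & Vector R V}.

#[short(type="hilbertType")]
HB.structure Definition Hilbert (R : realType) :=
  {V of InnerModule R V & Complete V}.

(* The norm, hence the topology, is induced by the scalar product. *)
HB.factory Record Lmodule_hasInner (R : realType) V & GRing.Lmodule R V := {
  inner : V -> V -> R;
  innerC : forall x y, inner x y = inner y x;
  innerDl : forall x y z, inner (x + y) z = inner x z + inner y z;
  innerZl : forall a x y, inner (a *: x) y = a * inner x y;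
  inner_gt0 : forall x, x != 0 -> 0 < inner x x
}.

HB.builders Context (R : realType) V & Lmodule_hasInner R V.

Let norm (x : V) : R := Num.sqrt (inner x x).

Let inner0l x : inner 0 x = 0.
Proof. by rewrite -(scale0r (0 : V)) innerZl mul0r. Qed.

Let innerDr x y z : inner x (y + z) = inner x y + inner x z.
Proof. by rewrite innerC innerDl !(innerC x). Qed.

Let innerZr a x y : inner x (a *: y) = a * inner x y.
Proof. by rewrite innerC innerZl innerC. Qed.

Let inner_ge0 x : 0 <= inner x x.
Proof.
by have [->|/inner_gt0/ltW//] := eqVneq x 0; rewrite inner0l.
Qed.

Let cauchy_schwarz x y : inner x y ^+ 2 <= inner x x * inner y y.
Proof.
have [->|y0] := eqVneq y 0.
  by rewrite (innerC x) !inner0l mulr0 expr0n.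
have yy := inner_gt0 y0.
have := inner_ge0 (inner y y *: x + (- inner x y) *: y).
rewrite !(innerDl, innerDr, innerZl, innerZr) (innerC y x) => h.
rewrite -subr_ge0 -(pmulr_rge0 _ yy); apply: (le_trans h).
by rewrite le_eqVlt; apply/orP; left; apply/eqP; ring.
Qed.

Let ler_normD x y : norm (x + y) <= norm x + norm y.
Proof.
rewrite /norm -(@ler_pXn2r _ 2)// ?nnegrE ?addr_ge0 ?sqrtr_ge0//.
rewrite sqrrD !sqr_sqrtr ?inner_ge0// innerDl !innerDr (innerC y x).
have : inner x y <= Num.sqrt (inner x x) * Num.sqrt (inner y y).
  rewrite -sqrtrM ?inner_ge0// (le_trans (ler_norm _))// -sqrtr_sqr.
  by rewrite ler_sqrt ?mulr_ge0 ?inner_ge0// cauchy_schwarz.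
by rewrite mulr2n; lra.
Qed.

Let normrZ (a : R) x : norm (a *: x) = `|a| * norm x.
Proof.
by rewrite /norm innerZl innerZr mulrA sqrtrM -expr2 ?sqr_ge0// sqrtr_sqr.
Qed.

Let normr0_eq0 x : norm x = 0 -> x = 0.
Proof.
move=> /eqP; rewrite sqrtr_eq0; apply: contraTeq => x0.
by rewrite -ltNge inner_gt0.
Qed.

HB.instance Definition _ := Lmodule_isNormed.Build R V ler_normD normrZ normr0_eq0.

Let inner_normr x : inner x x = `|x| ^+ 2.
Proof. by rewrite [`|x|]/(norm x) sqr_sqrtr// inner_ge0. Qed.

HB.instance Definition _ :=
  NormedModule_hasInner.Build R V innerC innerDl innerZl inner_normr.

HB.end.

Section inner_theory.
Context (R : realType) (V : innerModType R).
Implicit Types x y z : V.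

Lemma inner0l x : inner 0 x = 0.
Proof. by rewrite -(scale0r (0 : V)) innerZl mul0r. Qed.

Lemma inner0r x : inner x 0 = 0.
Proof. by rewrite innerC inner0l. Qed.

Lemma innerDr x y z : inner x (y + z) = inner x y + inner x z.
Proof. by rewrite innerC innerDl !(innerC x). Qed.

Lemma innerZr a x y : inner x (a *: y) = a * inner x y.
Proof. by rewrite innerC innerZl innerC. Qed.

Lemma inner_gt0 x : x != 0 -> 0 < inner x x.
Proof. by move=> x0; rewrite inner_normr exprn_gt0// normr_gt0. Qed.

Lemma inner_suml I (r : seq I) (P : pred I) (F : I -> V) y :
  inner (\sum_(i <- r | P i) F i) y = \sum_(i <- r | P i) inner (F i) y.
Proof.
apply: (big_morph (fun x => inner x y)); first by move=> ? ?; exact: innerDl.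
exact: inner0l.
Qed.

Lemma inner_sumr I (r : seq I) (P : pred I) (F : I -> V) y :
  inner y (\sum_(i <- r | P i) F i) = \sum_(i <- r | P i) inner y (F i).
Proof. by rewrite innerC inner_suml; apply: eq_bigr => i _; rewrite innerC. Qed.

End inner_theory.

Section subspace_inner.
Context (R : realType) (E : euclidType R) (U : {vspace E}).
Implicit Types x y z : subvs_of U.

Let sinner x y : R := inner (vsval x) (vsval y).

Let sinnerC x y : sinner x y = sinner y x.
Proof. exact: innerC. Qed.

Let sinnerDl x y z : sinner (x + y) z = sinner x z + sinner y z.
Proof. by rewrite /sinner linearD innerDl. Qed.

Let sinnerZl a x y : sinner (a *: x) y = a * sinner x y.
Proof. by rewrite /sinner linearZ/= innerZl. Qed.

Let sinner_gt0 x : x != 0 -> 0 < sinner x x.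
Proof.
move=> x0; apply: inner_gt0; apply: contraNneq x0 => x0.
by apply/eqP/val_inj; rewrite [LHS]x0 [RHS](linear0 (@vsval R E U)).
Qed.

HB.instance Definition _ := Lmodule_hasInner.Build R (subvs_of U)
  sinnerC sinnerDl sinnerZl sinner_gt0.

End subspace_inner.


(* An element of the tensor product is given by its coordinates with respect to
   the products of the library's bases of the two factors. *)
Definition tensor (R : fieldType) (V1 V2 : vectType R) :=
  'M[R]_(\dim {:V1}, \dim {:V2}).

HB.instance Definition _ (R : fieldType) (V1 V2 : vectType R) :=
  Vector.copy (tensor V1 V2) 'M[R]_(\dim {:V1}, \dim {:V2}).

Section tensor.
Context (R : fieldType) (V1 V2 : vectType R).

Definition tens (x : V1) (y : V2) : tensor V1 V2 :=
  \matrix_(i, j) (coord (vbasis {:V1}) i x * coord (vbasis {:V2}) j y).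

(* The linear map on the tensor product determined by a bilinear map B; see
   tlift_tens. *)
Definition tlift (W : lmodType R) (B : V1 -> V2 -> W) (u : tensor V1 V2) : W :=
  \sum_i \sum_j u i j *: B (vbasis {:V1})`_i (vbasis {:V2})`_j.

Lemma tliftD W B (u v : tensor V1 V2) :
  @tlift W B (u + v) = tlift B u + tlift B v.
Proof.
rewrite /tlift -big_split; apply: eq_bigr => i _ /=.
by rewrite -big_split; apply: eq_bigr => j _ /=; rewrite mxE scalerDl.
Qed.

Lemma tliftZ W B a (u : tensor V1 V2) : @tlift W B (a *: u) = a *: tlift B u.
Proof.
rewrite /tlift scaler_sumr; apply: eq_bigr => i _.
by rewrite scaler_sumr; apply: eq_bigr => j _; rewrite mxE scalerA.
Qed.

Lemma tlift_tens (W : lmodType R) (B : V1 -> V2 -> W) (x : V1) (y : V2) :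
  (forall a x x' y, B (a *: x + x') y = a *: B x y + B x' y) ->
  (forall a x y y', B x (a *: y + y') = a *: B x y + B x y') ->
  tlift B (tens x y) = B x y.
Proof.
move=> Bl Br.
have B0l y' : B 0 y' = 0.
  by have := Bl 1 0 0 y'; rewrite !scale1r addr0 => /eqP; rewrite addrC -subr_eq subrr => /eqP <-.
have B0r x' : B x' 0 = 0.
  by have := Br 1 x' 0 0; rewrite !scale1r addr0 => /eqP; rewrite addrC -subr_eq subrr => /eqP <-.
rewrite [in RHS](coord_vbasis (memvf x)) [in RHS](coord_vbasis (memvf y)).
have -> n (c : 'I_n -> R) (e : 'I_n -> V1) z :
    B (\sum_i c i *: e i) z = \sum_i c i *: B (e i) z.
  elim/big_ind2 : _ => //.
  - by move=> _ a _ b <- <-; have := Bl 1 a b z; rewrite !scale1r.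
  - by move=> i _; have := Bl (c i) (e i) 0 z; rewrite !addr0 B0l addr0.
apply: eq_bigr => i _.
have -> n (c : 'I_n -> R) (e : 'I_n -> V2) z :
    B z (\sum_i c i *: e i) = \sum_i c i *: B z (e i).
  elim/big_ind2 : _ => //.
  - by move=> _ a _ b <- <-; have := Br 1 z a b; rewrite !scale1r.
  - by move=> k _; have := Br (c k) z (e k) 0; rewrite !addr0 B0r addr0.
by rewrite scaler_sumr; apply: eq_bigr => j _; rewrite mxE scalerA.
Qed.

End tensor.

(* T1 \otimes T2 *)
Definition tmap (R : fieldType) (V1 V2 W1 W2 : vectType R)
    (T1 : V1 -> W1) (T2 : V2 -> W2) : tensor V1 V2 -> tensor W1 W2 :=
  tlift (fun x y => tens (T1 x) (T2 y)).

(* u = \sum_k x_k \otimes y_k is sent to phi |-> \sum_k phi(x_k) y_k. *)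
Definition tensor_op (R : fieldType) (V1 V2 : vectType R) (u : tensor V1 V2)
    (phi : 'Hom(V1, R^o)) : V2 :=
  tlift (fun x y => (phi x : R) *: y) u.


Lemma orthonormal_expansion (R : realType) (E : euclidType R) (X : seq E) :
  exists2 s : seq E, {subset s <= <<X>>%VS} &
    {in <<X>>%VS, forall y, y = \sum_(g <- s) inner y g *: g}.
Proof.
elim: X => [|x X [s sX sE]].
  by exists [::] => // y; rewrite span_nil memv0 big_nil => /eqP.
pose p := \sum_(g <- s) inner x g *: g; pose w := x - p.
have pX : p \in <<X>>%VS.
  by rewrite /p big_seq memv_suml// => g gs; rewrite memvZ// sX.
have XS y : y \in <<X>>%VS -> y \in <<x :: X>>%VS.
  by move=> yX; rewrite span_cons -[y]add0r memv_add// mem0v.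
have wX y : y \in <<X>>%VS -> inner w y = 0.
  move=> yX; rewrite /w innerDl -scaleN1r innerZl mulN1r.
  rewrite {1}(sE y yX) /p inner_sumr inner_suml -sumrB big1// => g _.
  by rewrite innerZr innerZl (innerC g) mulrC subrr.
have [w0|w0] := eqVneq w 0.
  have xX : x \in <<X>>%VS by move/eqP: w0; rewrite subr_eq0 => /eqP ->.
  have -> : <<x :: X>>%VS = <<X>>%VS.
    by rewrite span_cons; apply/addv_idPr; rewrite -memvE.
  by exists s.
have ww : `|w| != 0 by rewrite normr_eq0.
have wS : w \in <<x :: X>>%VS.
  by rewrite /w rpredB ?(XS p)// memv_span// mem_head.
exists (`|w|^-1 *: w :: s).
  by move=> g; rewrite inE => /predU1P[->|/sX/XS//]; rewrite memvZ.
move=> y; rewrite span_cons => /memv_addP[_ /vlineP[c ->]] [y0 y0X ->].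
rewrite big_cons.
have xpw : x = w + p by rewrite /w subrK.
have e1 : inner (c *: x + y0) (`|w|^-1 *: w) = c * `|w|.
  rewrite innerZr innerDl innerZl xpw innerDl !(innerC _ w) (wX p)// (wX y0)//.
  by rewrite addr0 addr0 inner_normr expr2; field.
rewrite e1 scalerA -mulrA divff// mulr1.
have -> : \sum_(g <- s) inner (c *: x + y0) g *: g = c *: p + y0.
  rewrite {2}(sE y0 y0X) /p scaler_sumr -big_split/=.
  by apply: eq_bigr => g _; rewrite innerDl innerZl scalerDl scalerA.
by rewrite addrA -scalerDr -xpw.
Qed.

Section tensor_inner.
Context (R : realType) (E1 E2 : euclidType R).
Implicit Types u v w : tensor E1 E2.

Definition tinner u v : R :=
  tlift (W := R^o) (fun x y =>
    tlift (W := R^o) (fun x' y' => inner x x' * inner y y') v) u.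

Lemma tinner_tens x y x' y' :
  tinner (tens x y) (tens x' y') = inner x x' * inner y y'.
Proof.
have H a b : tlift (W := R^o) (fun x' y' => inner a x' * inner b y') (tens x' y')
    = inner a x' * inner b y'.
  rewrite tlift_tens// => c ? ? ?; rewrite innerDr innerZr.
    by rewrite mulrDl -mulrA.
  by rewrite mulrDr mulrCA.
rewrite /tinner tlift_tens ?H// => c ? ? ?; rewrite !H innerDl innerZl.
  by rewrite mulrDl -mulrA.
by rewrite mulrDr mulrCA.
Qed.

Let tinnerDl u v w : tinner (u + v) w = tinner u w + tinner v w.
Proof. exact: tliftD. Qed.

Let tinnerZl a u v : tinner (a *: u) v = a * tinner u v.
Proof. exact: tliftZ. Qed.

Let tinnerC u v : tinner u v = tinner v u.
Proof.
rewrite /tinner /tlift.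
rewrite [LHS]pair_bigA [RHS]pair_bigA/=.
under eq_bigr => p _ do rewrite pair_bigA/= scaler_sumr.
under [RHS]eq_bigr => p _ do rewrite pair_bigA/= scaler_sumr.
rewrite exchange_big/=; apply: eq_bigr => p _; apply: eq_bigr => q _.
rewrite (innerC _ (vbasis _)`_p.1) (innerC _ (vbasis _)`_p.2).
by rewrite /GRing.scale/= mulrCA.
Qed.

Let tinner_sum (s : seq E2)
    (w := fun u g => tlift (fun x y => inner y g *: x) u) :
  (forall y z, inner y z = \sum_(g <- s) inner y g * inner z g) ->
  forall u, tinner u u = \sum_(g <- s) inner (w u g) (w u g).
Proof.
move=> sE u; rewrite /tinner /w /tlift.
under [RHS]eq_bigr => g _.
  rewrite inner_suml; under eq_bigr => i _.
    rewrite inner_suml; under eq_bigr => j _.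
      rewrite inner_sumr; under eq_bigr => k _.
        rewrite inner_sumr; under eq_bigr => l _ do
          rewrite !(innerZl, innerZr).
        over.
      over.
    over.
  over.
rewrite [RHS]exchange_big/=; apply: eq_bigr => i _.
rewrite [RHS]exchange_big/=; apply: eq_bigr => j _.
rewrite scaler_sumr [RHS]exchange_big/=; apply: eq_bigr => k _.
rewrite scaler_sumr [RHS]exchange_big/=; apply: eq_bigr => l _.
rewrite sE /GRing.scale/= !mulr_sumr; apply: eq_bigr => g _.
ring.
Qed.

Let tinner_gt0 u : u != 0 -> 0 < tinner u u.
Proof.
have [s _ sE] := orthonormal_expansion (vbasis {:E2}).
have {}sE y z : inner y z = \sum_(g <- s) inner y g * inner z g.
  rewrite [in LHS](sE y) ?(span_basis (vbasisP _)) ?memvf// inner_suml.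
  by apply: eq_bigr => g _; rewrite innerZl (innerC g).
move=> u0; rewrite (tinner_sum sE) lt_neqAle.
have ge0 (g : E2) : true ->
    0 <= inner (tlift (fun (x : E1) y => inner y g *: x) u)
               (tlift (fun x y => inner y g *: x) u).
  by move=> _; rewrite inner_normr sqr_ge0.
rewrite sumr_ge0 ?andbT; last by move=> g _; exact: ge0.
apply: contraNneq u0 => /esym/eqP; rewrite psumr_eq0// => /allP/= w0.
have free1 := basis_free (vbasisP {:E1}).
have free2 := basis_free (vbasisP {:E2}).
apply/eqP/matrixP => i j; rewrite mxE.
apply: (freeP free2 (fun j => u i j) _ j).
apply/eqP; apply: contraT => /inner_gt0; rewrite sE big_seq big1 ?ltxx// => g.
move=> /w0; rewrite inner_normr sqrf_eq0 normr_eq0 => /eqP wg0.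
suff -> : inner (\sum_j0 u i j0 *: (vbasis {:E2})`_j0) g = 0 by rewrite mul0r.
rewrite inner_suml.
apply: (freeP free1
  (fun i => \sum_j inner (u i j *: (vbasis {:E2})`_j) g) _ i).
rewrite -[RHS]wg0; apply: eq_bigr => k _.
by rewrite scaler_suml; apply: eq_bigr => l _; rewrite innerZl scalerA.
Qed.

HB.instance Definition _ := Lmodule_hasInner.Build R (tensor E1 E2)
  tinnerC tinnerDl tinnerZl tinner_gt0.

End tensor_inner.


Section bodies.
Context (R : realType).
Implicit Types E : euclidType R.

Definition convex_body E (P : set E) :=
  [/\ compact P, convex_set P & P° !=set0].

Definition sym_convex_body E (P : set E) :=
  convex_body P /\ P = [set - x | x in P].

Definition polar E (C : set E) : set E :=
  [set y | forall x, C x -> inner x y <= 1].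

Definition convex_hull E (A : set E) : set E := smallest (@convex_set R E) A.

Definition ptens E1 E2 (P1 : set E1) (P2 : set E2) : set (tensor E1 E2) :=
  convex_hull [set tens x1 x2 | x1 in P1 & x2 in P2].

Definition etens E1 E2 (P1 : set E1) (P2 : set E2) : set (tensor E1 E2) :=
  polar (ptens (polar P1) (polar P2)).

(* Only the values on pairs of symmetric convex bodies are meaningful. *)
Definition body_operation := forall E1 E2 : euclidType R,
  set E1 -> set E2 -> set (tensor E1 E2).

Definition sub_operation (alpha beta : body_operation) :=
  forall (E1 E2 : euclidType R) (P1 : set E1) (P2 : set E2),
    sym_convex_body P1 -> sym_convex_body P2 ->
    alpha E1 E2 P1 P2 `<=` beta E1 E2 P1 P2.

Record is_tensor_product (alpha : body_operation) : Prop := {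
  tensor_body : forall (E1 E2 : euclidType R) (P1 : set E1) (P2 : set E2),
    sym_convex_body P1 -> sym_convex_body P2 ->
    sym_convex_body (alpha E1 E2 P1 P2);
  tensor_ge_pi : sub_operation ptens alpha;
  tensor_le_eps : sub_operation alpha etens;
  tensor_map : forall (E1 E2 F1 F2 : euclidType R)
      (T1 : {linear E1 -> F1}) (T2 : {linear E2 -> F2})
      (P1 : set E1) (P2 : set E2) (Q1 : set F1) (Q2 : set F2),
    sym_convex_body P1 -> sym_convex_body P2 ->
    sym_convex_body Q1 -> sym_convex_body Q2 ->
    T1 @` P1 `<=` Q1 -> T2 @` P2 `<=` Q2 ->
    tmap T1 T2 @` alpha E1 E2 P1 P2 `<=` alpha F1 F2 Q1 Q2
}.

(* P_i \cap M_i is a body of the Euclidean space M_i = subvs_of M_i, and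
   M_1 \otimes M_2 is identified with its image in E_1 \otimes E_2. *)
Definition injective_tensor (alpha : body_operation) :=
  forall (E1 E2 : euclidType R) (P1 : set E1) (P2 : set E2)
    (M1 : {vspace E1}) (M2 : {vspace E2}),
  sym_convex_body P1 -> sym_convex_body P2 ->
  let incl := tmap (@vsval R E1 M1) (@vsval R E2 M2) in
  incl @` alpha (subvs_of M1) (subvs_of M2)
            (@vsval R E1 M1 @^-1` P1) (@vsval R E2 M2 @^-1` P2) =
  alpha E1 E2 P1 P2 `&` range incl.

Definition pi_inj E1 E2 (P1 : set E1) (P2 : set E2) : set (tensor E1 E2) :=
  [set z | forall beta : body_operation,
     is_tensor_product beta -> injective_tensor beta ->
     sub_operation ptens beta -> beta E1 E2 P1 P2 z].

End bodies.


Section tensor_norms.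
Context (R : realType).

Definition gauge_norm (V : lmodType R) (P : set V) (x : V) : R :=
  inf [set l | 0 < l /\ P (l^-1 *: x)].

Definition op_values (V W : lmodType R) (N1 : V -> R) (N2 : W -> R)
    (T : V -> W) : set R :=
  [set N2 (T x) | x in [set x | N1 x <= 1]].

(* inf and sup are 0 on sets without the corresponding bound, so boundedness is
   required explicitly wherever opnorm is used in infinite dimension. *)
Definition opnorm (V W : lmodType R) (N1 : V -> R) (N2 : W -> R)
  (T : V -> W) : R := sup (op_values N1 N2 T).

Definition bounded_op (V W : lmodType R) (N1 : V -> R) (N2 : W -> R)
  (T : V -> W) := has_ubound (op_values N1 N2 T).

Definition dual_norm (V : vectType R) (N : V -> R) (phi : 'Hom(V, R^o)) : R :=
  opnorm N (@Num.norm R R^o) phi.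

Definition omega2 (V1 V2 : vectType R) (N1 : V1 -> R) (N2 : V2 -> R)
    (u : tensor V1 V2) : R :=
  inf [set r | exists (H : hilbertType R)
      (S : {linear 'Hom(V1, R^o) -> H}) (T : {linear H -> V2}),
    [/\ bounded_op (dual_norm N1) (@Num.norm R H) S,
        bounded_op (@Num.norm R H) N2 T,
        tensor_op u =1 T \o S
      & r = opnorm (@Num.norm R H) N2 T * opnorm (dual_norm N1) (@Num.norm R H) S]].

Definition pi_norm (V1 V2 : vectType R) (N1 : V1 -> R) (N2 : V2 -> R)
    (u : tensor V1 V2) : R :=
  inf [set r | exists n (x : 'I_n -> V1) (y : 'I_n -> V2),
    u = \sum_k tens (x k) (y k) /\ r = \sum_k N1 (x k) * N2 (y k)].

(* The norm of 'rV[R]_m is the maximum norm, that is, 'rV[R]_m is l_oo^m. *)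
Definition K_G : R :=
  inf [set K | forall m n (u : tensor 'rV[R]_m 'rV[R]_n),
    pi_norm (@Num.norm R 'rV[R]_m) (@Num.norm R 'rV[R]_n) u <=
    K * omega2 (@Num.norm R 'rV[R]_m) (@Num.norm R 'rV[R]_n) u].

Definition w2tens (E1 E2 : euclidType R) (P1 : set E1) (P2 : set E2) :
  set (tensor E1 E2) := [set z | omega2 (gauge_norm P1) (gauge_norm P2) z <= 1].

End tensor_norms.

(* Main.v *)
Require Import Defs.
From HB Require Import structures.
From mathcomp Require Import all_boot all_order all_algebra.
From mathcomp Require Import all_classical all_reals all_analysis.
From mathcomp Require Import lra.

Set Implicit Arguments.
Unset Strict Implicit.
Unset Printing Implicit Defensive.

Import Order.TTheory GRing.Theory Num.Theory.
Import numFieldNormedType.Exports.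

Local Open Scope classical_set_scope.
Local Open Scope ring_scope.

(** The second inclusion holds because omega_2 is itself an injective tensor
    product of symmetric bodies that contains the projective one, so it takes
    part in the intersection that defines pi^inj. The first inclusion says that
    every injective tensor product beta contains K_G^-1 P1 (x)_omega2 P2.

    Both halves rest on a finite dimensional description of omega_2
    ([w2tensP]): up to factors arbitrarily close to 1, omega_2(z) <= 1 means that
    z = \sum_k a_k (x) b_k where c |-> \sum_k c_k a_k and c |-> \sum_k c_k b_k
    map the Euclidean unit ball into P1 and P2 ([hilbert_factorable]). A
    factorization through a Hilbert space gives such families by expansion in
    an orthonormal basis of the range of the first factor; the bound in P1 is
    the bipolar theorem. Conversely two such families define a factorization
    through l2.

    In this form the axioms of a tensor product are elementary: convexity comes
    from concatenating families with square root weights, the bound by the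
    injective tensor product is the Cauchy-Schwarz inequality, and the mapping
    property is composition. Injectivity ([factorable_subspace]) is an
    orthogonal projection argument: if z lies in M1 (x) M2, the coefficients that
    the family a sends into M1 form a subspace of l2; the family b is invariant
    under the orthogonal projection onto it, so this projection moves a into M1
    and changes neither z nor the norm bounds.

    For the first inclusion, a body P is, up to a factor t < 1, a section of a
    cube ([cube_section]): take finitely many functionals that form a fine net of
    the polar of P. The maps into the cubes carry a factorable z to a tensor u
    with omega_2(u) <= 1 in l_oo^m (x) l_oo^n, so pi(u) <= K_G and u / K_G lies in
    the projective tensor product of the cubes, up to a factor close to 1, hence in
    their beta product. As beta is injective, u / K_G comes from the beta product
    of the two sections, which the mapping property sends back to P1 and P2
    ([factorable_sub_injective]). Only the defining inequality of K_G is used. If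
    no constant satisfied it, the infimum K_G would be 0, and then K_G^-1 = 0 and
    the inclusion would be trivial ([K_G_bound]). *)

(** * Inner product spaces *)

Section InnerNorm.
Context (R : realType) (V : innerModType R).
Implicit Types x y : V.

Lemma inner_le_norm x y : inner x y <= `|x| * `|y|.
Proof.
have [->|x0] := eqVneq x 0; first by rewrite inner0l normr0 mul0r.
have [->|y0] := eqVneq y 0; first by rewrite inner0r normr0 mulr0.
have xy : 0 < `|x| * `|y| by rewrite mulr_gt0// normr_gt0.
have : 0 <= inner (`|y| *: x + (- `|x|) *: y) (`|y| *: x + (- `|x|) *: y).
  by rewrite inner_normr sqr_ge0.
rewrite !(innerDl, innerDr, innerZl, innerZr) (innerC y x).
rewrite !inner_normr => h.
by rewrite -(ler_pM2l xy); nra.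
Qed.

Lemma abs_inner_le_norm x y : `|inner x y| <= `|x| * `|y|.
Proof.
rewrite ler_norml inner_le_norm andbT lerNl -mulN1r -innerZl.
by rewrite (le_trans (inner_le_norm _ _))// normrZ normrN1 mul1r.
Qed.

Lemma norm_le_of_inner x y : inner x x <= inner x y -> `|x| <= `|y|.
Proof.
have [->|x0] := eqVneq x 0; first by rewrite normr0.
rewrite inner_normr => /le_trans/(_ (inner_le_norm _ _)).
by rewrite expr2 ler_pM2l ?normr_gt0.
Qed.

(** First order condition for a nearest point: x cannot be shortened by moving
    it along y. *)
Lemma inner_le0_of_norm_min x y :
  (forall t : R, 0 < t -> t <= 1 -> `|x| <= `|x - t *: y|) -> inner x y <= 0.
Proof.
move=> xy.
have ht t : 0 < t -> t <= 1 -> 2 * inner x y <= t * inner y y.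
  move=> t0 t1; have := xy t t0 t1.
  rewrite -(@ler_pXn2r _ 2) ?nnegrE// -!inner_normr -scaleNr.
  rewrite !(innerDl, innerDr, innerZl, innerZr) (innerC y x) => h.
  rewrite -(ler_pM2l t0); nra.
have yy : 0 <= inner y y by rewrite inner_normr sqr_ge0.
rewrite leNgt; apply/negP => xy0.
have k0 : 0 < inner y y + inner x y by rewrite ltr_wpDl.
have := ht (inner x y / (inner y y + inner x y)).
rewrite divr_gt0// ler_pdivrMr// mul1r lerDr yy => /(_ isT isT).
rewrite mulrAC ler_pdivlMr//; nra.
Qed.

End InnerNorm.

Section NormedAux.
Context (R : realType) (V W : normedModType R).

Lemma linear_continuous_of_bound (f : {linear V -> W}) (C : R) :
  (forall x, `|f x| <= C * `|x|) -> continuous f.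
Proof.
move=> fC; apply/linear_bounded_continuous/linear_boundedP.
exists C; split=> [|r Cr x]; first exact: num_real.
by apply: le_trans (fC x) _; apply: ler_wpM2r => //; exact: ltW.
Qed.

Lemma closed_of_approx (A : set V) :
  (forall x, (forall e, 0 < e -> exists2 y, A y & `|x - y| < e) -> A x) ->
  closed A.
Proof.
move=> HA x clx; apply: HA => e e0.
have [|y [Ay]] := clx (ball x e); first by apply/nbhs_ballP; exists e.
by rewrite -ball_normE /= => xy; exists y.
Qed.

Lemma closed_approx (A : set V) x : closed A ->
  (forall e, 0 < e -> exists2 y, A y & `|x - y| < e) -> A x.
Proof.
move=> clA xA; apply: clA => U /nbhs_ballP[e /= e0 eU].
by have [y Ay xy] := xA e e0; exists y; split=> //; apply: eU; rewrite -ball_normE.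
Qed.

End NormedAux.

Section EuclideanSpace.
Context (R : realType) (E : euclidType R).
Implicit Types (x y : E) (s : seq E).

Lemma orthonormal_expansion_full :
  exists s : seq E, forall y, y = \sum_(g <- s) inner y g *: g.
Proof.
have [s _ sE] := orthonormal_expansion (vbasis {:E}).
by exists s => y; apply: sE; rewrite (span_basis (vbasisP _)) memvf.
Qed.

Lemma linear_bounded (W : normedModType R) (f : {linear E -> W}) :
  exists2 C, 0 < C & forall x, `|f x| <= C * `|x|.
Proof.
have [s sE] := orthonormal_expansion_full.
exists (1 + \sum_(g <- s) `|g| * `|f g|).
  by rewrite ltr_pwDl// sumr_ge0// => g _; rewrite mulr_ge0.
move=> x; rewrite {1}(sE x) linear_sum (le_trans (ler_norm_sum _ _ _))//.
rewrite mulrDl mul1r ler_wpDl// mulr_suml ler_sum// => g _.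
rewrite linearZ/= normrZ mulrC (mulrC `|g|) -mulrA ler_wpM2l//.
by rewrite mulrC abs_inner_le_norm.
Qed.

Lemma inner_inj x y : (forall z, inner x z = inner y z) -> x = y.
Proof.
move=> xy; apply/eqP; rewrite -subr_eq0; apply: contraT => /inner_gt0.
by rewrite innerDl -scaleN1r innerZl xy mulN1r subrr ltxx.
Qed.

(** The coordinates in an orthonormal expansion of a bounded set are bounded, so
    the set lies in a continuous image of a compact box of row vectors. *)
Lemma euclid_compact (A : set E) (M : R) :
  closed A -> (forall x, A x -> `|x| <= M) -> compact A.
Proof.
move=> clA AM; have [s sE] := orthonormal_expansion_full.
pose f (v : 'rV[R]_(size s)) : E := \sum_i v ord0 i *: s`_i.
have flin : linear f.
  move=> a u v; rewrite /f scaler_sumr -big_split; apply: eq_bigr => i _ /=.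
  by rewrite !mxE scalerDl scalerA.
pose F := HB.pack_for {linear 'rV[R]_(size s) -> E} f
  (GRing.isLinear.Build _ _ _ _ _ flin).
have fc : continuous f.
  apply: (@linear_continuous_of_bound _ _ _ F (\sum_(i < size s) `|s`_i|)).
  move=> v; rewrite (le_trans (ler_norm_sum _ _ _))// mulr_suml ler_sum// => i _.
  rewrite normrZ mulrC ler_wpM2l// [leRHS]/Num.norm/= mx_normrE.
  by apply/bigmax_geP; right; exists (ord0, i).
pose B := f @` (f @^-1` A `&` [set v : 'rV[R]_(size s) |
  forall i : 'I_(size s), `|v ord0 i| <= M * `|s`_i|]).
have cB : compact B.
  apply: continuous_compact; first exact: continuous_subspaceT.
  apply: bounded_closed_compact.
    exists (\sum_(i < size s) `|M * `|s`_i| |); split; first exact: num_real.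
    move=> r rM v [_ vM]; apply: le_trans (ltW rM); rewrite [leLHS]/Num.norm/= mx_normrE.
    apply/bigmax_leP; split; first exact: sumr_ge0.
    move=> [i j] _ /=; rewrite (ord1 i) (le_trans (vM j))//.
    rewrite (le_trans (ler_norm _))// (bigD1 j)//= lerDl.
    exact: sumr_ge0.
  apply: closedI; first by apply: closed_comp => // v _; exact: fc.
  have -> : [set v : 'rV[R]_(size s) |
      forall i : 'I_(size s), `|v ord0 i| <= M * `|s`_i|] =
      \bigcap_(i : 'I_(size s)) [set v : 'rV[R]_(size s) | `|v ord0 i| <= M * `|s`_i|].
    by apply/seteqP; split => v /= h i; [move=> _|]; exact: h.
  apply: closed_bigI => i _; apply: closed_of_approx => v vA.
  apply/ler_addgt0Pr => e e0; have [w wA vw] := vA e e0.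
  rewrite -(subrK (w ord0 i) (v ord0 i)) (le_trans (ler_normD _ _))// addrC.
  apply: lerD => //; apply: le_trans (ltW vw).
  rewrite [leRHS]/Num.norm/= mx_normrE.
  by apply/bigmax_geP; right; exists (ord0, i) => //=; rewrite !mxE.
apply: (subclosed_compact clA cB) => x Ax; exists (\row_i inner x s`_i).
  have fx : f (\row_i inner x s`_i) = x.
    rewrite /f [in RHS](sE x) (big_nth 0) big_mkord.
    by apply: eq_bigr => i _; rewrite mxE.
  split; first by rewrite /= fx.
  move=> i /=; rewrite mxE (le_trans (abs_inner_le_norm _ _))//.
  by rewrite ler_wpM2r// AM.
rewrite /f [in RHS](sE x) (big_nth 0) big_mkord.
by apply: eq_bigr => i _; rewrite mxE.
Qed.

Lemma euclid_complete (F : set_system E) :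
  ProperFilter F -> cauchy F -> cvg F.
Proof.
move=> FF Fc; have [x Fx] := (cauchyP F).1 Fc _ ltr01.
apply: (compact_cauchy_cvg FF Fc (U := closed_ball x 1)).
  by apply: filterS Fx; exact: subset_closed_ball.
apply: (@euclid_compact _ (`|x| + 1)); first exact: closed_ball_closed.
rewrite closed_ballE// /closed_ball_ => y /= xy.
rewrite -(subrK x y) (le_trans (ler_normD _ _))// addrC lerD2l distrC//.
Qed.

End EuclideanSpace.

(** * Symmetric convex bodies, polars and gauges *)

Section Bodies.
Context (R : realType) (E : euclidType R).
Implicit Types (x y : E) (P : set E).

Lemma convex_setP P : convex_set P <->
  forall x y (t : R), P x -> P y -> 0 <= t -> t <= 1 ->
    P (t *: x + (1 - t) *: y).
Proof.
split=> [cP x y t Px Py t0 t1|cP x y t].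
  by have := cP x y (Itv01 t0 t1); rewrite !inE; apply.
by rewrite !inE => Px Py; apply: cP.
Qed.

(** The form in which symmetry and convexity are used: closure under absolutely
    convex combinations. *)
Definition abs_convex P :=
  forall x y (a b : R), P x -> P y -> `|a| + `|b| <= 1 -> P (a *: x + b *: y).

Lemma abs_convex_set P : abs_convex P -> convex_set P.
Proof.
move=> aP; apply/convex_setP => x y t Px Py t0 t1; apply: aP => //.
by rewrite !ger0_norm// ?subr_ge0//; lra.
Qed.

Lemma abs_convexZ P x (a : R) : abs_convex P -> P x -> `|a| <= 1 -> P (a *: x).
Proof.
move=> aP Px a1; rewrite -[_ *: _]addr0 -(scale0r x).
by apply: aP; rewrite ?normr0 ?addr0.
Qed.

Lemma convex_sym_abs_convex P : convex_set P -> (forall x, P x -> P (- x)) ->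
  abs_convex P.
Proof.
move=> /convex_setP cP oP x y a b Px Py ab.
have sP z (c : R) : P z -> P (Num.sg c *: z).
  move=> Pz; have [c0|c0|->] := ltrgtP c 0.
  - by rewrite ltr0_sg// scaleN1r; exact: oP.
  - by rewrite gtr0_sg// scale1r.
  rewrite sgr0 scale0r; have := cP z (- z) 2^-1 Pz (oP _ Pz).
  by rewrite scalerN -scalerBl (_ : _ - _ = 0 :> R) ?scale0r; [apply; lra|lra].
have P0 : P 0 by have := sP _ 0 Px; rewrite sgr0 scale0r.
have [ab0|ab0] := eqVneq (`|a| + `|b|) 0.
  have [a0 b0] : a = 0 /\ b = 0.
    by split; apply/normr0_eq0; have := normr_ge0 a; have := normr_ge0 b; lra.
  by rewrite a0 b0 !scale0r addr0.
have abp : 0 < `|a| + `|b| by rewrite lt_neqAle eq_sym ab0 addr_ge0.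
set s := `|a| + `|b|.
have -> : a *: x + b *: y = s *: ((`|a| / s) *: (Num.sg a *: x)
    + (1 - `|a| / s) *: (Num.sg b *: y)) + (1 - s) *: 0.
  rewrite scaler0 addr0 scalerDr !scalerA; congr (_ *: _ + _ *: _).
    by rewrite mulrCA divff// mulr1 mulrC -numEsg.
  rewrite mulrBr mulr1 mulrCA divff// mulr1 /s addrAC subrr add0r.
  by rewrite mulrC -numEsg.
apply: (cP) => //; last exact: ltW.
apply: cP; [exact: sP|exact: sP|by rewrite divr_ge0// ltW|].
by rewrite ler_pdivrMr// mul1r lerDl.
Qed.

Lemma abs_convex_sum P n (w : 'I_n -> R) (v : 'I_n -> E) : abs_convex P -> P 0 ->
  (forall k, P (v k)) -> \sum_k `|w k| <= 1 -> P (\sum_k w k *: v k).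
Proof.
move=> aP P0; elim: n w v => [|n IH] w v Pv w1; first by rewrite big_ord0.
rewrite big_ord_recl; move: w1; rewrite big_ord_recl.
set s := \sum_i _ => w1.
have s0 : 0 <= s by exact: sumr_ge0.
have [sz|sz] := eqVneq s 0.
  rewrite big1 ?addr0; first by apply: abs_convexZ => //; rewrite sz addr0 in w1.
  move=> i _; move/eqP : sz; rewrite psumr_eq0// => /allP/(_ i).
  by rewrite mem_index_enum normr_eq0 => /(_ isT)/eqP ->; rewrite scale0r.
have -> : \sum_(i < n) w (lift ord0 i) *: v (lift ord0 i) =
    s *: \sum_(i < n) (w (lift ord0 i) / s) *: v (lift ord0 i).
  rewrite scaler_sumr; apply: eq_bigr => i _; rewrite scalerA; congr (_ *: _).
  by rewrite mulrCA divff ?mulr1.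
apply: aP => //; last by rewrite (ger0_norm s0).
apply: IH => //.
under eq_bigr do rewrite normrM normfV (ger0_norm s0).
by rewrite -mulr_suml divff.
Qed.

(** In finite dimension, an absorbing absolutely convex set is a neighbourhood
    of 0: it contains small multiples of a spanning family, hence all
    combinations of the family with small coefficients. *)
Lemma absorbing_ball P : abs_convex P ->
  (forall x, exists2 t : R, 0 < t & P (t *: x)) ->
  exists2 e : R, 0 < e & forall x, `|x| <= e -> P x.
Proof.
move=> aP absP; have [s sE] := orthonormal_expansion_full E.
have P0 : P 0.
  have [t _ Pt] := absP 0; rewrite -(scale0r (t *: 0)).
  by apply: abs_convexZ; rewrite ?normr0.
have [e e0 He] : exists2 e : R, 0 < e & forall c : E -> R,
    (forall g, g \in s -> `|c g| <= e) -> P (\sum_(g <- s) c g *: g).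
  elim: s {sE} => [|g s [e e0 He]].
    by exists 1 => // c _; rewrite big_nil.
  have [t t0 Pt] := absP g; exists (Num.min (t / 2) (e / 2)).
    by rewrite lt_min !divr_gt0.
  move=> c ce; rewrite big_cons.
  have -> : c g *: g + \sum_(h <- s) c h *: h =
      (c g / t) *: (t *: g) + 2^-1 *: \sum_(h <- s) (2 * c h) *: h.
    rewrite scalerA divfK ?gt_eqF//; congr (_ + _).
    by rewrite scaler_sumr; apply: eq_bigr => h _; rewrite scalerA mulrA mulVf ?mul1r.
  apply: aP => //; last first.
    rewrite normrM normfV (gtr0_norm t0) (@ger0_norm _ 2^-1) ?invr_ge0//.
    have /ce : g \in g :: s by rewrite mem_head.
    rewrite le_min => /andP[cg _].
    have : `|c g| / t <= 2^-1 by rewrite ler_pdivrMr// mulrC.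
    by move: (_ / t) => z; lra.
  apply: He => h hs; have /ce : h \in g :: s by rewrite inE hs orbT.
  rewrite le_min => /andP[_ ch]; rewrite normrM (@ger0_norm _ 2)//.
  by move: ch; move: `|c h| => z; lra.
pose M := 1 + \sum_(g <- s) `|g|.
have M0 : 0 < M by rewrite /M ltr_pwDl// sumr_ge0.
exists (e / M); first by rewrite divr_gt0.
move=> x xe; rewrite (sE x); apply: He => g gs.
rewrite (le_trans (abs_inner_le_norm _ _))//.
apply: le_trans (_ : e / M * M <= _); last by rewrite divfK ?gt_eqF.
apply: ler_pM => //; rewrite /M (big_rem g gs)/=.
by rewrite addrCA lerDl addr_ge0// sumr_ge0.
Qed.

(** Working form of the definition. A symmetric convex set with an interior point
    z contains a ball around 0, the midpoint of z and - z. *)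
Lemma sym_convex_bodyP P : sym_convex_body P <->
  [/\ closed P, exists M : R, forall x, P x -> `|x| <= M, abs_convex P
    & exists2 e : R, 0 < e & forall x, `|x| <= e -> P x].
Proof.
split=> [[[cptP cP [z Pz]] PN]|[clP [M PM] aP [e e0 Pe]]].
  have oP x : P x -> P (- x) by move=> Px; rewrite PN; exists x.
  have aP := convex_sym_abs_convex cP oP; split => //.
  - exact: compact_closed (@norm_hausdorff _ _) cptP.
  - by have /ex_strict_bound_gt0[M _ PM] := compact_bounded cptP; exists M => x /PM/ltW.
  - move/nbhs_ballP : Pz => [e /= e0 ez]; exists (e / 3); first by rewrite divr_gt0.
    move=> x xe; have -> : x = 2^-1 *: (z + 2 *: x) + (- 2^-1) *: z.
      by rewrite scalerDr scalerA mulVf// scale1r scaleNr addrAC subrr add0r.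
    apply: aP.
    + apply: ez; rewrite -ball_normE /= opprD addNKr normrN normrZ.
      by rewrite (@ger0_norm _ 2)//; move: xe e0; move: `|x| => u; lra.
    + by apply: ez; rewrite -ball_normE/= subrr normr0.
    + by rewrite normrN ger0_norm ?invr_ge0//; lra.
split.
  split; [exact: euclid_compact clP PM|exact: abs_convex_set|].
  exists 0; apply/nbhs_ballP; exists e => // x.
  by rewrite -ball_normE /= sub0r normrN => /ltW/Pe.
have oP x : P x -> P (- x).
  by move=> Px; rewrite -scaleN1r; apply: abs_convexZ; rewrite ?normrN1.
by apply/seteqP; split => [x Px|_ [x Px <-]]; [exists (- x); rewrite ?opprK; auto|auto].
Qed.

Section OneBody.
Context (P : set E) (bP : sym_convex_body P).

Lemma body_closed : closed P. Proof. by have/sym_convex_bodyP[] := bP. Qed.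

Lemma body_abs_convex : abs_convex P.
Proof. by have/sym_convex_bodyP[] := bP. Qed.

Lemma body_ball : exists2 e : R, 0 < e & forall x, `|x| <= e -> P x.
Proof. by have/sym_convex_bodyP[] := bP. Qed.

Lemma body_bounded : exists2 M : R, 0 < M & forall x, P x -> `|x| <= M.
Proof.
have/sym_convex_bodyP[_ [M PM] _ _] := bP; exists (`|M| + 1).
  by rewrite ltr_wpDl.
by move=> x /PM/le_trans; apply; rewrite (le_trans (ler_norm _))// lerDl.
Qed.

Lemma body0 : P 0.
Proof. by have [e e0] := body_ball; apply; rewrite normr0 ltW. Qed.

Lemma body_absorbing x : exists2 t : R, 0 < t & P (t *: x).
Proof.
have [e e0 Pe] := body_ball; exists (e / (`|x| + 1)).
  by rewrite divr_gt0// ltr_wpDl.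
apply: Pe; rewrite normrZ gtr0_norm ?divr_gt0 ?ltr_wpDl//.
by rewrite mulrAC ler_pdivrMr ?ltr_wpDl// ler_pM2l// lerDl.
Qed.

Lemma bodyZ x (a : R) : P x -> `|a| <= 1 -> P (a *: x).
Proof. exact: abs_convexZ body_abs_convex. Qed.

Lemma bodyN x : P x -> P (- x).
Proof. by move=> Px; rewrite -scaleN1r; apply: bodyZ; rewrite ?normrN1. Qed.

(** Every estimate with a constant arbitrarily close to 1 passes to the limit by
    this lemma. *)
Lemma body_radially_closed x :
  (forall t : R, 0 < t -> t < 1 -> P (t *: x)) -> P x.
Proof.
move=> Px; have [->|x0] := eqVneq x 0; first exact: body0.
have nx : 0 < `|x| by rewrite normr_gt0.
apply: body_closed => U /nbhs_ballP[e /= e0 eU].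
pose t := Num.max 2^-1 (1 - e / 2 / `|x|).
have t1 : t < 1.
  by rewrite /t gt_max; apply/andP; split; [lra|rewrite ltrBlDr ltrDl !divr_gt0].
have t0 : 0 < t by rewrite /t lt_max invr_gt0 ltr0n.
exists (t *: x); split; first exact: Px.
apply: eU; rewrite -ball_normE /= -{1}[x]scale1r -scalerBl normrZ ger0_norm; last lra.
apply: le_lt_trans (_ : e / 2 / `|x| * `|x| < _).
  rewrite ler_pM2r//; have : 1 - e / 2 / `|x| <= t by rewrite /t le_max lexx orbT.
  by move: (_ / `|x|) => u; lra.
by rewrite divfK ?gt_eqF//; lra.
Qed.

Lemma polar_body_le x y : P x -> polar P y -> `|inner x y| <= 1.
Proof.
move=> Px Py; rewrite ler_norml lerNl Py// andbT.
by rewrite -mulN1r -innerZl scaleN1r; apply: Py; exact: bodyN.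
Qed.

(** Bipolar theorem: the nearest point of P to an outside point x yields a
    functional that separates x from P. *)
Lemma bipolar x : (forall y, polar P y -> inner x y <= 1) -> P x.
Proof.
move=> Hx; apply: contrapT => nPx.
have [[cptP _ _] _] := bP.
have dc : continuous (fun z : E => `|x - z|).
  by move=> z; apply: cvg_norm; apply: cvgB; [exact: cvg_cst|exact: cvg_id].
have [|||p pP pmin] := @compact_EVT_min _ R (fun z => `|x - z|) P.
- by exists 0; exact: body0.
- exact: cptP.
- exact: continuous_subspaceT.
have {}pmin z : P z -> `|x - p| <= `|x - z| by move=> Pz; apply: pmin; rewrite inE.
have {}pP : P p by rewrite inE in pP.
pose w := x - p.
have w0 : w != 0 by apply: contra_notN nPx; rewrite subr_eq0 => /eqP ->.
have wz z : P z -> inner w z <= inner w p.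
  move=> Pz; rewrite -subr_le0 -mulN1r -innerZr -innerDr scaleN1r.
  apply: inner_le0_of_norm_min => t t0 t1; rewrite /w -addrA -opprD.
  apply: pmin; have -> : p + t *: (z - p) = t *: z + (1 - t) *: p.
    by rewrite scalerBr scalerBl scale1r addrCA.
  apply: body_abs_convex => //; rewrite !ger0_norm ?subr_ge0//; last exact: ltW.
  by rewrite addrCA subrr addr0.
have [e e0 Pe] := body_ball.
have nw : 0 < `|w| by rewrite normr_gt0.
have m0 : 0 < inner w p.
  have /wz : P ((e / `|w|) *: w).
    by apply: Pe; rewrite normrZ gtr0_norm ?divr_gt0// divfK ?gt_eqF.
  apply: lt_le_trans; rewrite innerZr mulr_gt0 ?divr_gt0//.
  exact: inner_gt0.
have /Hx : polar P ((inner w p)^-1 *: w).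
  move=> z Pz; rewrite innerZr (innerC z) mulrC ler_pdivrMr// mul1r; exact: wz.
rewrite innerZr mulrC ler_pdivrMr// mul1r leNgt => /negP; apply.
have -> : inner x w = inner w p + inner w w.
  by rewrite (innerC w p) -innerDl /w addrCA subrr addr0.
by rewrite ltrDl inner_gt0.
Qed.

Lemma polar_compact : compact (polar P).
Proof.
have [e e0 Pe] := body_ball.
apply: (@euclid_compact _ _ _ e^-1).
  apply: closed_of_approx => y Hy x Px; apply/ler_addgt0Pr => d d0.
  have [z Pz yz] := Hy (d / (`|x| + 1)) (divr_gt0 d0 (ltr_wpDl (normr_ge0 _) ltr01)).
  rewrite -(subrK z y) innerDr addrC lerD//; first exact: Pz.
  rewrite (le_trans (inner_le_norm _ _))//.
  apply: le_trans (_ : (`|x| + 1) * (d / (`|x| + 1)) <= _).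
    by apply: ler_pM => //; [rewrite lerDl|exact: ltW].
  by rewrite mulrCA divff ?mulr1// gt_eqF// ltr_wpDl.
move=> y Py; have [->|y0] := eqVneq y 0; first by rewrite normr0 invr_ge0 ltW.
have ny : 0 < `|y| by rewrite normr_gt0.
have /Py : P ((e / `|y|) *: y).
  by apply: Pe; rewrite normrZ gtr0_norm ?divr_gt0// divfK ?gt_eqF.
rewrite innerZl inner_normr expr2 mulrA divfK ?gt_eqF//.
by rewrite mulrC -ler_pdivlMr// mul1r.
Qed.

Lemma polar_absorbing y : exists2 t : R, 0 < t & polar P (t *: y).
Proof.
have [M M0 PM] := body_bounded; exists (M * (`|y| + 1))^-1.
  by rewrite invr_gt0 mulr_gt0// ltr_wpDl.
move=> x Px; rewrite innerZr mulrC ler_pdivrMr ?mulr_gt0 ?ltr_wpDl// mul1r.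
rewrite (le_trans (inner_le_norm _ _))// ler_pM//; first exact: PM.
by rewrite lerDl.
Qed.

(** Closedness of P makes the infimum in the gauge attained. *)
Lemma gauge_le (x : E) (l : R) : 0 < l -> gauge_norm P x <= l <-> P (l^-1 *: x).
Proof.
move=> l0; split=> [gl|Pl]; last first.
  by apply: ge_inf => //; exists 0 => r [/ltW].
apply: body_radially_closed => t t0 t1.
have [t' t'0 Pt'] := body_absorbing x.
have [||r [r0 Pr] rl] := @inf_lt _ [set l | 0 < l /\ P (l^-1 *: x)] (l / t).
- by exists t'^-1; split; rewrite ?invr_gt0 ?invrK.
- by apply: le_lt_trans gl _; rewrite ltr_pdivlMr// gtr_pMr.
have -> : t *: (l^-1 *: x) = (t / l * r) *: (r^-1 *: x).
  by rewrite !scalerA -mulrA divff ?mulr1 ?gt_eqF.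
apply: bodyZ => //; rewrite ger0_norm; last by rewrite !mulr_ge0 ?invr_ge0// ltW.
move/ltW : rl; rewrite ler_pdivlMr// mulrC => rl.
by rewrite mulrAC ler_pdivrMr// mul1r.
Qed.

Lemma gauge_ge0 (x : E) : 0 <= gauge_norm P x.
Proof.
have [t t0 Pt] := body_absorbing x; apply: lb_le_inf => [|r [/ltW//]].
by exists t^-1; split; rewrite ?invr_gt0 ?invrK.
Qed.

Lemma gauge_le1 (x : E) : gauge_norm P x <= 1 <-> P x.
Proof. by rewrite gauge_le// invr1 scale1r. Qed.

(** A body is approximated from outside by a polytope: the constraints given by
    a fine enough finite net of the polar body. *)
Lemma polytope_approx (t : R) : 0 < t -> t < 1 ->
  exists m (y : 'I_m -> E), (forall j, polar P (y j)) /\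
    forall x, (forall j, `|inner x (y j)| <= 1) -> P (t *: x).
Proof.
move=> t0 t1; have [M M0 PM] := body_bounded.
(* With a net of mesh d, the gauge g of x satisfies g <= 1 + d * M * g, and
   this d makes g at most t^-1. *)
pose d := (1 - t) / M.
have d0 : 0 < d by rewrite divr_gt0// subr_gt0.
have := polar_compact; rewrite compact_cover.
case/(_ E (polar P) (fun y => ball y d)).
- by move=> y _; exact: ball_open.
- by move=> y Py; exists y => //; exact: ballxx.
move=> D DP Dcov; pose s : seq E := finmap.enum_fset D.
exists (size s), (fun j => s`_j); split.
  by move=> j; have := DP s`_j; rewrite inE; apply; exact: mem_nth.
move=> x xs; pose g := gauge_norm P x.
have g0 : 0 <= g by exact: gauge_ge0.
have xg : `|x| <= M * g.
  apply/ler_addgt0Pr => e e0.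
  have l0 : 0 < g + e / M by rewrite ltr_wpDl// divr_gt0.
  have /(gauge_le _ l0)/PM : gauge_norm P x <= g + e / M.
    by rewrite lerDl divr_ge0// ltW.
  rewrite normrZ gtr0_norm ?invr_gt0// mulrC ler_pdivrMr// mulrDr mulrCA divff ?mulr1//.
  by rewrite gt_eqF.
have k0 : 0 < 1 + d * (M * g).
  apply: ltr_wpDr => //; apply: mulr_ge0; first exact: ltW.
  by apply: mulr_ge0 => //; exact: ltW.
have : g <= 1 + d * (M * g).
  apply/(gauge_le _ k0)/bipolar => y Py.
  rewrite innerZl mulrC ler_pdivrMr// mul1r.
  have [z zD yz] := Dcov _ Py.
  rewrite -(subrK z y) innerDr addrC lerD//.
    have zs : (index z s < size s)%N by rewrite index_mem.
    by have := xs (Ordinal zs); rewrite /= nth_index// => /(le_trans (ler_norm _)).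
  rewrite (le_trans (inner_le_norm _ _))// mulrC ler_pM//.
  by move: yz; rewrite -ball_normE /= distrC => /ltW.
rewrite mulrA divfK ?gt_eqF// => gt; have {}gt : g <= t^-1.
  by rewrite -[_^-1]mul1r ler_pdivlMr//; lra.
by move/gauge_le : gt; rewrite invr_gt0 invrK; apply.
Qed.

End OneBody.
End Bodies.

(** * Algebra of tensors *)

Definition dual_coord (R : fieldType) (V : vectType R) (i : 'I_(\dim {:V})) :
  'Hom(V, R^o) := linfun (coord (vbasis {:V}) i : V -> R^o).

Lemma dual_coordE (R : fieldType) (V : vectType R) (i : 'I_(\dim {:V})) (x : V) :
  dual_coord i x = coord (vbasis {:V}) i x.
Proof. exact: lfunE. Qed.

Section TensorAlgebra.
Context (R : fieldType) (V1 V2 : vectType R).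
Implicit Types (x : V1) (y : V2) (u : tensor V1 V2).

Lemma tensDl x x' y : tens (x + x') y = tens x y + tens x' y.
Proof. by apply/matrixP => i j; rewrite !mxE linearD mulrDl. Qed.

Lemma tensDr x y y' : tens x (y + y') = tens x y + tens x y'.
Proof. by apply/matrixP => i j; rewrite !mxE linearD mulrDr. Qed.

Lemma tensZl a x y : tens (a *: x) y = a *: tens x y.
Proof. by apply/matrixP => i j; rewrite !mxE linearZ mulrA. Qed.

Lemma tensZr a x y : tens x (a *: y) = a *: tens x y.
Proof. by apply/matrixP => i j; rewrite !mxE linearZ mulrCA. Qed.

Lemma tens0l y : tens (0 : V1) y = 0.
Proof. by rewrite -(scale0r 0) tensZl scale0r. Qed.

Lemma tens0r x : tens x (0 : V2) = 0.
Proof. by rewrite -(scale0r 0) tensZr scale0r. Qed.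

Lemma tens_suml n (x : 'I_n -> V1) y :
  tens (\sum_k x k) y = \sum_k tens (x k) y.
Proof.
by apply: (big_morph (fun x => tens x y) (fun x x' => tensDl x x' y)); exact: tens0l.
Qed.

Lemma tens_sumr n x (y : 'I_n -> V2) :
  tens x (\sum_k y k) = \sum_k tens x (y k).
Proof. by apply: (big_morph _ (tensDr x)); exact: tens0r. Qed.

End TensorAlgebra.

Section TensorMaps.
Context (R : fieldType) (V1 V2 W1 W2 : vectType R).
Implicit Types (x : V1) (y : V2) (u : tensor V1 V2).

(** Identities between maps on a tensor product are checked on this form. *)
Lemma tensor_decomp u :
  exists n (x : 'I_n -> V1) (y : 'I_n -> V2), u = \sum_k tens (x k) (y k).
Proof.
exists (\dim {:V1}), (fun i => (vbasis {:V1})`_i),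
  (fun i => \sum_j u i j *: (vbasis {:V2})`_j).
have f1 := basis_free (vbasisP {:V1}); have f2 := basis_free (vbasisP {:V2}).
apply/matrixP => i j; rewrite summxE (bigD1 i)//= [X in _ + X]big1 ?addr0.
  by rewrite mxE coord_free// eqxx mul1r coord_sum_free.
by move=> l li; rewrite mxE coord_free// (negbTE li) mul0r.
Qed.

Lemma tlift_sum (W : lmodType R) (B : V1 -> V2 -> W) n (u : 'I_n -> tensor V1 V2) :
  tlift B (\sum_k u k) = \sum_k tlift B (u k).
Proof.
apply: big_morph; first exact: tliftD.
by rewrite -(scale0r 0) tliftZ scale0r.
Qed.

Lemma tmap_tens (T1 : {linear V1 -> W1}) (T2 : {linear V2 -> W2}) x y :
  tmap T1 T2 (tens x y) = tens (T1 x) (T2 y).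
Proof.
rewrite /tmap tlift_tens//= => a *.
  by rewrite linearP tensDl tensZl.
by rewrite linearP tensDr tensZr.
Qed.

Lemma tmap_sum_tens (T1 : {linear V1 -> W1}) (T2 : {linear V2 -> W2}) n
    (x : 'I_n -> V1) (y : 'I_n -> V2) :
  tmap T1 T2 (\sum_k tens (x k) (y k)) = \sum_k tens (T1 (x k)) (T2 (y k)).
Proof. by rewrite /tmap tlift_sum; apply: eq_bigr => k _; exact: tmap_tens. Qed.

Lemma tmapZ (T1 : V1 -> W1) (T2 : V2 -> W2) a u :
  tmap T1 T2 (a *: u) = a *: tmap T1 T2 u.
Proof. exact: tliftZ. Qed.

Lemma tensor_op_sum_tens n (x : 'I_n -> V1) (y : 'I_n -> V2) (phi : 'Hom(V1, R^o)) :
  tensor_op (\sum_k tens (x k) (y k)) phi = \sum_k (phi (x k) : R) *: y k.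
Proof.
rewrite /tensor_op tlift_sum; apply: eq_bigr => k _.
rewrite tlift_tens// => a *.
  by rewrite linearP scalerDl scalerA.
by rewrite scalerDr !scalerA mulrC.
Qed.

(** The entries of u are the coordinates of the values of its operator at the
    dual basis. *)
Lemma tensor_op_inj u v : tensor_op u =1 tensor_op v -> u = v.
Proof.
move=> uv; apply/matrixP => i j.
have f1 := basis_free (vbasisP {:V1}); have f2 := basis_free (vbasisP {:V2}).
have E w : tensor_op w (dual_coord i) =
    \sum_j w i j *: (vbasis {:V2})`_j.
  rewrite /tensor_op /tlift (bigD1 i)//= [X in _ + X]big1 ?addr0.
    by apply: eq_bigr => l _; rewrite lfunE/= coord_free// eqxx scale1r.
  move=> k ki; apply: big1 => l _.
  by rewrite dual_coordE coord_free// (negbTE ki) scale0r scaler0.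
have := uv (dual_coord i); rewrite !E.
by move/(congr1 (coord (vbasis {:V2}) j)); rewrite !coord_sum_free.
Qed.

End TensorMaps.

Lemma tmap_scale (R : fieldType) (V1 V2 : vectType R)
    (T1 : {linear V1 -> V1}) (T2 : {linear V2 -> V2}) (a b : R)
    (u : tensor V1 V2) :
  (forall x, T1 x = a *: x) -> (forall y, T2 y = b *: y) ->
  tmap T1 T2 u = (a * b) *: u.
Proof.
move=> T1a T2b; have [n [x [y ->]]] := tensor_decomp u.
rewrite tmap_sum_tens scaler_sumr; apply: eq_bigr => k _.
by rewrite T1a T2b tensZl tensZr scalerA.
Qed.

Lemma tmap_comp (R : fieldType) (U1 U2 V1 V2 W1 W2 : vectType R)
    (T1 : {linear V1 -> W1}) (T2 : {linear V2 -> W2})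
    (S1 : {linear U1 -> V1}) (S2 : {linear U2 -> V2}) (u : tensor U1 U2) :
  tmap T1 T2 (tmap S1 S2 u) = tmap (T1 \o S1) (T2 \o S2) u.
Proof.
have [n [x [y ->]]] := tensor_decomp u.
by rewrite !tmap_sum_tens.
Qed.

Lemma tmap_subspace_corestrict (R : fieldType) (U1 U2 V1 V2 : vectType R)
    (M1 : {vspace V1}) (M2 : {vspace V2})
    (J1 : {linear U1 -> V1}) (J2 : {linear U2 -> V2}) (u : tensor U1 U2) :
  (forall x, J1 x \in M1) -> (forall x, J2 x \in M2) ->
  tmap (@vsval R V1 M1) (@vsval R V2 M2) (tmap (vsproj M1 \o J1) (vsproj M2 \o J2) u) =
  tmap J1 J2 u.
Proof.
move=> JM1 JM2; have [n [x [y ->]]] := tensor_decomp u.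
by rewrite !tmap_sum_tens; apply: eq_bigr => k _; rewrite /= !vsprojK.
Qed.

Lemma tmap_subspace_inj (R : fieldType) (V1 V2 : vectType R)
    (M1 : {vspace V1}) (M2 : {vspace V2}) :
  injective (tmap (@vsval R V1 M1) (@vsval R V2 M2)).
Proof.
apply: (can_inj (g := tmap (vsproj M1) (vsproj M2))) => v.
have [n [x [y ->]]] := tensor_decomp v; rewrite !tmap_sum_tens.
by apply: eq_bigr => k _; rewrite /= !vsvalK.
Qed.

Lemma inner_tens (R : realType) (E1 E2 : euclidType R) (x x' : E1) (y y' : E2) :
  inner (tens x y) (tens x' y') = inner x x' * inner y y'.
Proof. exact: tinner_tens. Qed.

(** * The Euclidean spaces l2 n *)

(** The space of n-tuples with the Euclidean norm; the row vectors themselves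
    carry the maximum norm. *)
Definition l2 (R : realType) (n : nat) : Type := 'rV[R]_n.

HB.instance Definition _ (R : realType) (n : nat) :=
  Vector.copy (l2 R n) 'rV[R]_n.

Section L2.
Context (R : realType) (n : nat).
Implicit Types c d : l2 R n.

Let l2inner c d : R := \sum_i c ord0 i * d ord0 i.

Let l2innerC c d : l2inner c d = l2inner d c.
Proof. by apply: eq_bigr => i _; rewrite mulrC. Qed.

Let l2innerDl c c' d : l2inner (c + c') d = l2inner c d + l2inner c' d.
Proof. by rewrite /l2inner -big_split; apply: eq_bigr => i _; rewrite mxE mulrDl. Qed.

Let l2innerZl a c d : l2inner (a *: c) d = a * l2inner c d.
Proof. by rewrite /l2inner mulr_sumr; apply: eq_bigr => i _; rewrite mxE mulrA. Qed.

Let l2inner_gt0 c : c != 0 -> 0 < l2inner c c.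
Proof.
move=> c0; rewrite lt_neqAle sumr_ge0 ?andbT; last first.
  by move=> i _; rewrite -expr2 sqr_ge0.
apply: contraNneq c0 => /esym/eqP; rewrite psumr_eq0; last first.
  by move=> i _; rewrite -expr2 sqr_ge0.
move=> /allP c0; apply/eqP/matrixP => i j; rewrite (ord1 i) mxE.
by apply/eqP; have := c0 j; rewrite mem_index_enum -expr2 sqrf_eq0; apply.
Qed.

HB.instance Definition _ := Lmodule_hasInner.Build R (l2 R n)
  l2innerC l2innerDl l2innerZl l2inner_gt0.

HB.instance Definition _ := Uniform_isComplete.Build (l2 R n)
  (@euclid_complete R (l2 R n)).

Lemma l2_innerE c d : inner c d = \sum_i c ord0 i * d ord0 i.
Proof. by []. Qed.

Lemma l2_norm_sqr c : `|c| ^+ 2 = \sum_i c ord0 i ^+ 2.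
Proof. by rewrite -inner_normr. Qed.

Lemma l2_coord_le c i : `|c ord0 i| <= `|c|.
Proof.
rewrite -(@ler_pXn2r _ 2) ?nnegrE// l2_norm_sqr (bigD1 i)//=.
by rewrite real_normK ?num_real// lerDl sumr_ge0// => j _; exact: sqr_ge0.
Qed.

End L2.

Section LinearCombinations.
Context (R : realType) (n : nat).

Definition l2_comb (V : lmodType R) (v : 'I_n -> V) (c : l2 R n) : V :=
  \sum_k c ord0 k *: v k.

Lemma l2_comb_is_linear (V : lmodType R) (v : 'I_n -> V) : linear (l2_comb v).
Proof.
move=> a c d; rewrite /l2_comb scaler_sumr -big_split; apply: eq_bigr => i _ /=.
by rewrite !mxE scalerDl scalerA.
Qed.

HB.instance Definition _ (V : lmodType R) (v : 'I_n -> V) :=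
  GRing.isLinear.Build R (l2 R n) V *:%R (l2_comb v) (l2_comb_is_linear v).

Definition l2_eval (V : vectType R) (v : 'I_n -> V) (phi : 'Hom(V, R^o)) : l2 R n :=
  \row_k (phi (v k) : R).

Lemma l2_eval_is_linear (V : vectType R) (v : 'I_n -> V) : linear (l2_eval v).
Proof. by move=> a phi psi; apply/rowP => k; rewrite !mxE !lfunE/= !lfunE. Qed.

HB.instance Definition _ (V : vectType R) (v : 'I_n -> V) :=
  GRing.isLinear.Build R 'Hom(V, R^o) (l2 R n) *:%R (l2_eval v)
    (l2_eval_is_linear v).

End LinearCombinations.

(** * Tensors that factor through a Euclidean space *)

Section L2Bounded.
Context (R : realType).

(** For the unit ball P of a norm, this says that the operator from l2 n that
    sends the k-th unit vector to a k has norm at most 1. *)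
Definition l2_bounded (V : lmodType R) n (a : 'I_n -> V) (P : set V) :=
  forall c : l2 R n, `|c| <= 1 -> P (l2_comb a c).

Section OneBody.
Context (E : euclidType R) (P : set E) (bP : sym_convex_body P).

Lemma l2_bounded_scale n (a : 'I_n -> E) (c : l2 R n) : l2_bounded a P ->
  exists2 p, P p & l2_comb a c = `|c| *: p.
Proof.
move=> aP; have [->|c0] := eqVneq c 0.
  by exists 0; [exact: body0|rewrite linear0 normr0 scale0r].
exists (l2_comb a (`|c|^-1 *: c)).
  by apply: aP; rewrite normrZ normfV normr_id mulVf// normr_eq0.
by rewrite linearZ/= scalerA divff ?scale1r// normr_eq0.
Qed.

(** Transposed form of the bound: the adjoint operator maps the polar of P into
    the unit ball of l2 n. *)
Lemma l2_bounded_polar n (a : 'I_n -> E) (y : E) : l2_bounded a P -> polar P y ->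
  \sum_k inner (a k) y ^+ 2 <= 1.
Proof.
move=> aP Py; pose c : l2 R n := \row_k inner (a k) y.
have cE : \sum_k inner (a k) y ^+ 2 = `|c| ^+ 2.
  by rewrite l2_norm_sqr; apply: eq_bigr => k _; rewrite mxE.
have [p Pp ac] := l2_bounded_scale c aP.
have : `|c| ^+ 2 = `|c| * inner p y.
  rewrite -innerZl -ac inner_suml -cE; apply: eq_bigr => k _.
  by rewrite innerZl mxE expr2.
rewrite cE => cc; have [->|c0] := eqVneq `|c| 0; first by rewrite expr0n.
rewrite expr_le1//; have := Py _ Pp.
by move: cc; rewrite expr2 => /(mulfI c0) <-.
Qed.

Lemma l2_bounded_cat n m (a : 'I_n -> E) (b : 'I_m -> E) (s t : R) :
  l2_bounded a P -> l2_bounded b P -> s ^+ 2 + t ^+ 2 <= 1 ->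
  l2_bounded (fun k => match fintype.split k with
                       | inl i => s *: a i | inr j => t *: b j end) P.
Proof.
move=> aP bbP st c c1.
pose c1' : l2 R n := \row_i c ord0 (lshift m i).
pose c2' : l2 R m := \row_j c ord0 (rshift n j).
have cc : `|c| ^+ 2 = `|c1'| ^+ 2 + `|c2'| ^+ 2.
  rewrite !l2_norm_sqr big_split_ord; congr (_ + _).
    by apply: eq_bigr => i _; rewrite mxE.
  by apply: eq_bigr => i _; rewrite mxE.
have [p Pp ap] := l2_bounded_scale c1' aP.
have [q Pq bq] := l2_bounded_scale c2' bbP.
have -> : l2_comb (fun k => match fintype.split k with
    | inl i => s *: a i | inr j => t *: b j end) c =
    (s * `|c1'|) *: p + (t * `|c2'|) *: q.
  rewrite -!scalerA -ap -bq /l2_comb big_split_ord; congr (_ + _).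
    rewrite scaler_sumr; apply: eq_bigr => i _.
    by rewrite (unsplitK (inl i)) mxE !scalerA mulrC.
  rewrite scaler_sumr; apply: eq_bigr => i _.
  by rewrite (unsplitK (inr i)) mxE !scalerA mulrC.
apply: body_abs_convex => //; rewrite !normrM !normr_id.
have : `|c| ^+ 2 <= 1 by rewrite expr_le1.
move: st; rewrite cc -(real_normK (num_real s)) -(real_normK (num_real t)).
move: `|s| `|t| `|c1'| `|c2'| => u v w z h1 h2.
have := sqr_ge0 (u - w); have := sqr_ge0 (v - z); nra.
Qed.

End OneBody.
End L2Bounded.

Section HilbertFactorable.
Context (R : realType).

(** The tensors of the form \sum_k a_k (x) b_k such that both families define
    maps of norm at most 1 from a finite dimensional Euclidean space: these are
    the tensors whose operator factors through a Euclidean space with constant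
    at most 1. *)
Definition hilbert_factorable (E1 E2 : euclidType R) (P1 : set E1) (P2 : set E2)
    (z : tensor E1 E2) :=
  exists n (a : 'I_n -> E1) (b : 'I_n -> E2),
    [/\ z = \sum_k tens (a k) (b k), l2_bounded a P1 & l2_bounded b P2].

Lemma factorable_map (E1 E2 F1 F2 : euclidType R)
    (T1 : {linear E1 -> F1}) (T2 : {linear E2 -> F2})
    (P1 : set E1) (P2 : set E2) (Q1 : set F1) (Q2 : set F2) z :
  (forall x, P1 x -> Q1 (T1 x)) -> (forall x, P2 x -> Q2 (T2 x)) ->
  hilbert_factorable P1 P2 z -> hilbert_factorable Q1 Q2 (tmap T1 T2 z).
Proof.
move=> PQ1 PQ2 [n [a [b [-> aP bP]]]].
exists n, (T1 \o a), (T2 \o b); split; first exact: tmap_sum_tens.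
- move=> c /aP/PQ1; rewrite /l2_comb linear_sum.
  by under eq_bigr do rewrite linearZ.
- move=> c /bP/PQ2; rewrite /l2_comb linear_sum.
  by under eq_bigr do rewrite linearZ.
Qed.

Section TwoBodies.
Context (E1 E2 : euclidType R) (P1 : set E1) (P2 : set E2).
Context (bP1 : sym_convex_body P1) (bP2 : sym_convex_body P2).
Local Notation hfac := (hilbert_factorable P1 P2).

(** The weights are spread evenly, as square roots, over the two families; that
    the resulting families are still bounded is the Cauchy-Schwarz
    inequality. *)
Lemma factorable_abs_convex : abs_convex hfac.
Proof.
move=> z w s t [n [a [b [-> aP bP]]]] [m [a' [b' [-> aP' bP']]]] st.
have sgM (r : R) : (Num.sg r * Num.sqrt `|r|) * Num.sqrt `|r| = r.
  by rewrite -mulrA -expr2 sqr_sqrtr// -numEsg.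
have sg2 (r : R) : (Num.sg r * Num.sqrt `|r|) ^+ 2 <= `|r|.
  rewrite exprMn sqr_sqrtr// ler_piMl// sqr_sg; by case: (r != 0).
exists (n + m)%N, (fun k => match fintype.split k with
    | inl i => (Num.sg s * Num.sqrt `|s|) *: a i
    | inr j => (Num.sg t * Num.sqrt `|t|) *: a' j end),
  (fun k => match fintype.split k with
    | inl i => Num.sqrt `|s| *: b i | inr j => Num.sqrt `|t| *: b' j end); split.
- rewrite big_split_ord !scaler_sumr; congr (_ + _); apply: eq_bigr => k _.
    by rewrite (unsplitK (inl k)) tensZl tensZr scalerA sgM.
  by rewrite (unsplitK (inr k)) tensZl tensZr scalerA sgM.
- by apply: l2_bounded_cat => //; apply: le_trans st; apply: lerD.
- by apply: l2_bounded_cat => //; rewrite !sqr_sqrtr.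
Qed.

Lemma factorable_tens x y : P1 x -> P2 y -> hfac (tens x y).
Proof.
move=> Px Py; exists 1%N, (fun=> x), (fun=> y); split; first by rewrite big_ord1.
- move=> c c1; rewrite /l2_comb big_ord1; apply: bodyZ => //.
  exact: le_trans (l2_coord_le c ord0) c1.
- move=> c c1; rewrite /l2_comb big_ord1; apply: bodyZ => //.
  exact: le_trans (l2_coord_le c ord0) c1.
Qed.

(** Since the property is absolutely convex, it is enough to scale elementary
    tensors. *)
Lemma factorable_absorbing z : exists2 t : R, 0 < t & hfac (t *: z).
Proof.
have [n [x [y ->]]] := tensor_decomp z.
elim/big_ind : _ => [|u v [s s0 us] [t t0 vt]|k _].
- by exists 1; rewrite // scaler0 -(tens0l _ 0); apply: factorable_tens; exact: body0.
- have st : 0 < s + t by rewrite addr_gt0.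
  exists (s * t / (s + t)); first by rewrite !mulr_gt0 ?invr_gt0.
  have -> : s * t / (s + t) *: (u + v) =
      (t / (s + t)) *: (s *: u) + (s / (s + t)) *: (t *: v).
    rewrite scalerDr !scalerA.
    by congr (_ *: _ + _ *: _); rewrite [RHS]mulrAC // (mulrC t).
  apply: factorable_abs_convex => //.
  rewrite !gtr0_norm ?divr_gt0//.
  by rewrite -mulrDl addrC divff// gt_eqF.
- have [s s0 Ps] := body_absorbing bP1 (x k).
  have [t t0 Pt] := body_absorbing bP2 (y k).
  exists (s * t); first by rewrite mulr_gt0.
  by rewrite -scalerA -tensZr -tensZl; apply: factorable_tens.
Qed.

(** The estimate behind the inclusion in the injective tensor product
    [etens]: it is the Cauchy-Schwarz inequality for two families tested on a
    pair of functionals. *)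
Lemma factorable_polar z y1 y2 : hfac z -> polar P1 y1 -> polar P2 y2 ->
  inner z (tens y1 y2) <= 1.
Proof.
move=> [n [a [b [-> aP bP]]]] Py1 Py2; rewrite inner_suml.
have h1 := l2_bounded_polar bP1 aP Py1; have h2 := l2_bounded_polar bP2 bP Py2.
rewrite -(ler_pM2l (ltr0n R 2)) mulr1.
apply: le_trans (lerD h1 h2); rewrite mulr_sumr -big_split ler_sum// => k _.
rewrite inner_tens; have := sqr_ge0 (inner (a k) y1 - inner (b k) y2).
by rewrite /=; nra.
Qed.

End TwoBodies.

(** Orthogonal projection p onto the coefficients that the family a sends into
    M. When the operator given by a and b takes its values in M, the family b
    is fixed by p, so that p can be applied to a without changing the tensor. *)
Lemma coefficient_projection (E1 E2 : euclidType R) n (a : 'I_n -> E1)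
    (b : 'I_n -> E2) (M : {vspace E1}) :
  (forall y, \sum_l inner (b l) y *: a l \in M) ->
  exists p : 'I_n -> 'I_n -> R,
    [/\ forall k l, p k l = p l k,
        forall k, \sum_l p k l *: a l \in M,
        forall k, \sum_l p k l *: b l = b k
      & forall c : l2 R n, `|(\row_k \sum_l p k l * c ord0 l) : l2 R n| <= `|c|].
Proof.
move=> Mab; pose A : 'Hom(l2 R n, E1) := linfun (l2_comb a).
pose U := (A @^-1: M)%VS.
have [s sU0 sE0] := orthonormal_expansion (vbasis U).
have sU g : g \in s -> l2_comb a g \in M.
  by move/sU0; rewrite (span_basis (vbasisP _)) -memv_preim lfunE.
have sE v : l2_comb a v \in M -> v = \sum_(g <- s) inner v g *: g.
  by move=> vM; apply: sE0; rewrite (span_basis (vbasisP _)) -memv_preim lfunE.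
exists (fun k l => \sum_(g <- s) g ord0 k * g ord0 l); split.
- by move=> k l; apply: eq_bigr => g _; rewrite mulrC.
- move=> k; have -> : \sum_l (\sum_(g <- s) g ord0 k * g ord0 l) *: a l =
      \sum_(g <- s) g ord0 k *: l2_comb a g.
    under eq_bigr do rewrite scaler_suml.
    rewrite exchange_big/=; apply: eq_bigr => g _; rewrite scaler_sumr.
    by apply: eq_bigr => l _; rewrite scalerA.
  by rewrite big_seq memv_suml// => g gs; rewrite memvZ// sU.
- move=> k; apply: inner_inj => y.
  pose v : l2 R n := \row_l inner (b l) y.
  have /sE vE : l2_comb a v \in M.
    rewrite (_ : l2_comb a v = \sum_l inner (b l) y *: a l) ?Mab//.
    by apply: eq_bigr => l _; rewrite mxE.
  have : v ord0 k = inner (b k) y by rewrite mxE.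
  move=> <-; rewrite [in RHS]vE summxE inner_suml.
  under eq_bigr do rewrite innerZl mulr_suml.
  rewrite exchange_big/=; apply: eq_bigr => g _; rewrite mxE l2_innerE mulr_suml.
  by apply: eq_bigr => l _; rewrite mxE mulrC mulrA mulrAC.
- move=> c; set d := (X in `|X|).
  have dE : d = \sum_(g <- s) inner c g *: g.
    apply/rowP => k; rewrite mxE summxE.
    under eq_bigr do rewrite mulr_suml.
    rewrite exchange_big/=; apply: eq_bigr => g _; rewrite mxE l2_innerE mulr_suml.
    by apply: eq_bigr => l _; rewrite mulrC mulrA mulrAC.
  have dM : l2_comb a d \in M.
    rewrite dE linear_sum big_seq memv_suml// => g gs.
    by rewrite linearZ memvZ// sU.
  apply: norm_le_of_inner; rewrite le_eqVlt; apply/orP; left; apply/eqP.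
  rewrite [in RHS](sE _ dM) inner_suml {2}dE inner_sumr.
  by apply: eq_bigr => g _; rewrite innerZl innerZr mulrC (innerC g).
Qed.

(** Injectivity of the Hilbertian tensor product: the two families of a
    factorization in the ambient spaces are projected, one after the other, into
    the subspaces. *)
Lemma factorable_subspace (E1 E2 : euclidType R) (P1 : set E1) (P2 : set E2)
    (M1 : {vspace E1}) (M2 : {vspace E2}) (z : tensor (subvs_of M1) (subvs_of M2)) :
  hilbert_factorable P1 P2 (tmap (@vsval R E1 M1) (@vsval R E2 M2) z) ->
  hilbert_factorable (@vsval R E1 M1 @^-1` P1) (@vsval R E2 M2 @^-1` P2) z.
Proof.
move=> [n [a [b [zE aP bP]]]].
have [m [x [y zxy]]] := tensor_decomp z.
have zxy' : \sum_k tens (a k) (b k) = \sum_k tens (vsval (x k)) (vsval (y k)).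
  by rewrite -zE zxy tmap_sum_tens.
(* Contracting z with a vector of one factor gives a combination of the
   family in the other factor; it lies in the subspace, as z does. *)
have contract1 N (u : 'I_N -> E1) (v : 'I_N -> E2) (w : E2) :
    tlift (fun x y => inner y w *: x) (\sum_k tens (u k) (v k)) =
    \sum_k inner (v k) w *: u k.
  rewrite tlift_sum; apply: eq_bigr => k _; rewrite tlift_tens// => r *.
    by rewrite scalerDr !scalerA mulrC.
  by rewrite innerDl innerZl scalerDl scalerA.
have contract2 N (u : 'I_N -> E1) (v : 'I_N -> E2) (w : E1) :
    tlift (fun x y => inner x w *: y) (\sum_k tens (u k) (v k)) =
    \sum_k inner (u k) w *: v k.
  rewrite tlift_sum; apply: eq_bigr => k _; rewrite tlift_tens// => r *.
    by rewrite innerDl innerZl scalerDl scalerA.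
  by rewrite scalerDr !scalerA mulrC.
have [|p [pC pM pb pc]] := @coefficient_projection _ _ n a b M1.
  move=> w; rewrite -contract1 zxy' contract1.
  by apply: rpred_sum => k _; rewrite rpredZ// subvsP.
pose a' k := \sum_l p k l *: a l.
have zE' : \sum_k tens (a' k) (b k) = \sum_k tens (a k) (b k).
  under eq_bigr do rewrite tens_suml.
  rewrite exchange_big/=; apply: eq_bigr => l _; rewrite -[in RHS]pb tens_sumr.
  by apply: eq_bigr => k _; rewrite tensZl tensZr pC.
have [|q [qC qM qa qc]] := @coefficient_projection _ _ n b a' M2.
  move=> w; rewrite -contract2 zE' zxy' contract2.
  by apply: rpred_sum => k _; rewrite rpredZ// subvsP.
pose b' k := \sum_l q k l *: b l.
have zE'' : \sum_k tens (a' k) (b' k) = \sum_k tens (a k) (b k).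
  rewrite -zE'; under eq_bigr do rewrite tens_sumr.
  rewrite exchange_big/=; apply: eq_bigr => l _; rewrite -[in RHS]qa tens_suml.
  by apply: eq_bigr => k _; rewrite tensZl tensZr qC.
have comb_proj (E : euclidType R) (P : set E) (v : 'I_n -> E) (r : 'I_n -> 'I_n -> R) :
    (forall k l, r k l = r l k) ->
    (forall c : l2 R n, `|(\row_k \sum_l r k l * c ord0 l) : l2 R n| <= `|c|) ->
    l2_bounded v P -> l2_bounded (fun k => \sum_l r k l *: v l) P.
  move=> rC rc vP c c1.
  have := vP _ (le_trans (rc c) c1); congr (P _).
  rewrite /l2_comb; under [RHS]eq_bigr do rewrite scaler_sumr.
  rewrite exchange_big/=; apply: eq_bigr => k _; rewrite mxE scaler_suml.
  by apply: eq_bigr => l _; rewrite scalerA mulrC rC.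
have vsval_comb (E : euclidType R) (M : {vspace E}) (P : set E) (v : 'I_n -> E) :
    (forall k, v k \in M) -> l2_bounded v P ->
    l2_bounded (vsproj M \o v) (@vsval R E M @^-1` P).
  move=> vM vP c /vP; rewrite /preimage/= /l2_comb linear_sum.
  by congr (P _); apply: eq_bigr => k _; rewrite linearZ/= vsprojK.
exists n, (vsproj M1 \o a'), (vsproj M2 \o b'); split.
- rewrite -tmap_sum_tens zE'' zxy' tmap_sum_tens zxy.
  by apply: eq_bigr => k _; rewrite /= !vsvalK.
- by apply: vsval_comb => //; exact: comb_proj.
- by apply: vsval_comb => //; exact: comb_proj.
Qed.

End HilbertFactorable.

(** * The Hilbertian tensor norm *)

Section OperatorNorm.
Context (R : realType).

Lemma opnorm_ge0 (V W : lmodType R) (N1 : V -> R) (N2 : W -> R) (T : V -> W) :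
  (forall y, 0 <= N2 y) -> 0 <= opnorm N1 N2 T.
Proof.
move=> N0; rewrite /opnorm.
have [hs|hs] := pselect (has_sup (op_values N1 N2 T)); last by rewrite sup_out.
have [[r rv] ub] := hs; apply: le_trans (ub_le_sup ub rv).
by case: rv => x _ <-.
Qed.

Lemma opnorm_le (V W : lmodType R) (N1 : V -> R) (N2 : W -> R) (T : V -> W) (r : R) :
  0 <= r -> (forall x, N1 x <= 1 -> N2 (T x) <= r) ->
  bounded_op N1 N2 T /\ opnorm N1 N2 T <= r.
Proof.
move=> r0 Tr; have ub : ubound (op_values N1 N2 T) r by move=> _ [x x1 <-]; exact: Tr.
split; first by exists r.
have [e0|/nonemptyPn e0] := pselect (op_values N1 N2 T !=set0); first exact: ge_sup.
by rewrite /opnorm e0 sup0.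
Qed.

Lemma le_opnorm (V W : lmodType R) (N1 : V -> R) (N2 : W -> R) (T : V -> W) x :
  bounded_op N1 N2 T -> N1 x <= 1 -> N2 (T x) <= opnorm N1 N2 T.
Proof. by move=> bT x1; apply: ub_le_sup => //; exists x. Qed.

End OperatorNorm.

(** Gram-Schmidt process. No dimension is assumed on V, so that the lemma applies
    to the arbitrary Hilbert spaces in the definition of omega2. *)
Lemma gram_schmidt (R : realType) (V : innerModType R) (X : seq V) :
  exists n (h : 'I_n -> V), (forall j k, inner (h j) (h k) = (j == k)%:R) /\
    {in X, forall x, x = \sum_k inner x (h k) *: h k}.
Proof.
elim: X => [|x X [n [h [hh hX]]]]; first by exists 0%N, (fun=> 0); split=> // -[].
pose p := \sum_k inner x (h k) *: h k; pose w := x - p.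
have wh k : inner w (h k) = 0.
  rewrite /w innerDl -scaleN1r innerZl inner_suml (bigD1 k)//= big1 ?addr0.
    by rewrite innerZl hh eqxx mulr1 mulN1r subrr.
  by move=> j jk; rewrite innerZl hh (negbTE jk) mulr0.
have [w0|w0] := eqVneq w 0.
  exists n, h; split=> // y; rewrite inE => /predU1P[->|/hX//].
  by move/eqP : w0; rewrite subr_eq0 => /eqP.
have nw : `|w| != 0 by rewrite normr_eq0.
exists n.+1, (fun k => oapp h (`|w|^-1 *: w) (unlift ord0 k)); split.
  move=> j k; case: (unliftP ord0 j) => [j' ->|->];
    case: (unliftP ord0 k) => [k' ->|->];
    rewrite ?liftK ?unlift_none/=.
  - by rewrite hh (inj_eq lift_inj).
  - by rewrite innerZr innerC wh mulr0.
  - by rewrite innerZl wh mulr0.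
  - by rewrite innerZl innerZr inner_normr expr2 mulKf// mulVf.
move=> y; rewrite inE big_ord_recl unlift_none/= => yX.
under eq_bigr do rewrite liftK/=.
case/predU1P : yX => [->|yX]; last first.
  have yw : inner y w = 0.
    rewrite (hX _ yX) inner_suml big1// => k _.
    by rewrite innerZl (innerC (h k)) wh mulr0.
  by rewrite -hX// innerZr yw mulr0 scale0r add0r.
rewrite -/p innerZr (_ : inner x w = `|w| ^+ 2).
  by rewrite expr2 mulKf// scalerA divff// scale1r /w subrK.
rewrite (_ : x = w + p); last by rewrite /w subrK.
rewrite innerDl inner_normr inner_suml big1 ?addr0// => k _.
by rewrite innerZl (innerC (h k)) wh mulr0.
Qed.

Section OmegaTwo.
Context (R : realType).

(** The set whose infimum is omega2. It has a name because it must be shown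
    nonempty before an upper bound on the infimum yields a factorization: the
    infimum of the empty set is 0. *)
Definition factorization_norms (V1 V2 : vectType R) (N1 : V1 -> R) (N2 : V2 -> R)
    (u : tensor V1 V2) : set R :=
  [set r | exists (H : hilbertType R)
      (S : {linear 'Hom(V1, R^o) -> H}) (T : {linear H -> V2}),
    [/\ bounded_op (dual_norm N1) (@Num.norm R H) S,
        bounded_op (@Num.norm R H) N2 T,
        tensor_op u =1 T \o S
      & r = opnorm (@Num.norm R H) N2 T * opnorm (dual_norm N1) (@Num.norm R H) S]].

(** The factorization goes through l2 n: the first factor evaluates a functional
    on the family a, the second forms linear combinations of b. The norm of the
    first factor is tested on the functional itself, at the vector with
    coefficients phi (a k). *)
Lemma factorization_norms_of_families (V1 V2 : vectType R) (N1 : V1 -> R) (N2 : V2 -> R)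
    n (a : 'I_n -> V1) (b : 'I_n -> V2) (r : R) :
  (forall y, 0 <= N2 y) ->
  (forall phi : 'Hom(V1, R^o), bounded_op N1 (@Num.norm R R^o) phi) ->
  0 <= r -> l2_bounded a [set x | N1 x <= 1] -> l2_bounded b [set y | N2 y <= r] ->
  exists2 r', factorization_norms N1 N2 (\sum_k tens (a k) (b k)) r' & r' <= r.
Proof.
move=> N20 N1b r0 aN bN.
have [bS S1] : bounded_op (dual_norm N1) (@Num.norm R (l2 R n)) (l2_eval a) /\
    opnorm (dual_norm N1) (@Num.norm R (l2 R n)) (l2_eval a) <= 1.
  apply: opnorm_le => // phi phi1; set c := l2_eval a phi.
  have [->|c0] := eqVneq c 0; first by rewrite normr0.
  have nc : `|c| != 0 by rewrite normr_eq0.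
  have x1 : N1 (l2_comb a (`|c|^-1 *: c)) <= 1.
    by apply: aN; rewrite normrZ normfV normr_id mulVf.
  have := le_opnorm (N1b phi) x1; rewrite -/(dual_norm N1 phi) => /le_trans/(_ phi1).
  rewrite linearZ/= linearZ/= normrZ normfV normr_id.
  have -> : phi (l2_comb a c) = `|c| ^+ 2 :> R.
    rewrite l2_norm_sqr linear_sum; apply: eq_bigr => k _.
    by rewrite linearZ/= expr2 [in RHS]mxE mxE.
  by rewrite normrX normr_id expr2 mulKf.
have [bT Tr] : bounded_op (@Num.norm R (l2 R n)) N2 (l2_comb b) /\
    opnorm (@Num.norm R (l2 R n)) N2 (l2_comb b) <= r.
  by apply: opnorm_le => // c /bN.
exists (opnorm (@Num.norm R (l2 R n)) N2 (l2_comb b) *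
    opnorm (dual_norm N1) (@Num.norm R (l2 R n)) (l2_eval a)).
  exists (l2 R n), (l2_eval a), (l2_comb b); split => // phi.
  rewrite tensor_op_sum_tens; apply: eq_bigr => k _; by rewrite mxE.
by rewrite -[leRHS]mulr1 ler_pM// opnorm_ge0.
Qed.

Lemma factorization_norms_ge0 (V1 V2 : vectType R) (N1 : V1 -> R) (N2 : V2 -> R) u r :
  (forall y, 0 <= N2 y) -> factorization_norms N1 N2 u r -> 0 <= r.
Proof.
by move=> N20 [H [S [T [_ _ _ ->]]]]; rewrite mulr_ge0// opnorm_ge0.
Qed.

Lemma omega2_le_families (V1 V2 : vectType R) (N1 : V1 -> R) (N2 : V2 -> R)
    n (a : 'I_n -> V1) (b : 'I_n -> V2) (r : R) :
  (forall y, 0 <= N2 y) ->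
  (forall phi : 'Hom(V1, R^o), bounded_op N1 (@Num.norm R R^o) phi) ->
  0 <= r -> l2_bounded a [set x | N1 x <= 1] -> l2_bounded b [set y | N2 y <= r] ->
  omega2 N1 N2 (\sum_k tens (a k) (b k)) <= r.
Proof.
move=> N20 N1b r0 aN bN.
have [r' r'f] := factorization_norms_of_families N20 N1b r0 aN bN.
apply: le_trans; apply: ge_inf => //.
by exists 0 => s; exact: factorization_norms_ge0.
Qed.

Section TwoBodies.
Context (E1 E2 : euclidType R) (P1 : set E1) (P2 : set E2).
Context (bP1 : sym_convex_body P1) (bP2 : sym_convex_body P2).
Local Notation hfac := (hilbert_factorable P1 P2).

Lemma gauge_functional_bounded (phi : 'Hom(E1, R^o)) :
  bounded_op (gauge_norm P1) (@Num.norm R R^o) phi.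
Proof.
have [M M0 PM] := body_bounded bP1.
have [C C0 pC] := linear_bounded (fun_of_lfun phi : {linear E1 -> R^o}).
exists (C * M) => _ [x /(gauge_le1 bP1)/PM xM <-].
by rewrite (le_trans (pC x))// ler_pM2l.
Qed.

Lemma l2_bounded_gauge (E : euclidType R) (P : set E) n (a : 'I_n -> E) (r : R) :
  sym_convex_body P -> 0 < r -> l2_bounded a P ->
  l2_bounded (fun k => r *: a k) [set x | gauge_norm P x <= r].
Proof.
move=> bP r0 aP c /aP Pc; apply/(gauge_le bP _ r0).
move: Pc; congr (P _); rewrite /l2_comb scaler_sumr; apply: eq_bigr => k _.
by rewrite !scalerA mulrAC mulVf ?mul1r// gt_eqF.
Qed.

Lemma factorable_norms z (r : R) : 0 < r -> hfac (r^-1 *: z) ->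
  exists2 r', factorization_norms (gauge_norm P1) (gauge_norm P2) z r' & r' <= r.
Proof.
move=> r0 [n [a [b [zE aP bP]]]].
have -> : z = \sum_k tens (a k) (r *: b k).
  under eq_bigr do rewrite tensZr.
  by rewrite -scaler_sumr -zE scalerA divff ?scale1r// gt_eqF.
apply: factorization_norms_of_families.
- exact: gauge_ge0.
- exact: gauge_functional_bounded.
- exact: ltW.
- by move=> c /aP /(gauge_le1 bP1).
- exact: l2_bounded_gauge.
Qed.

(** A factorization through an arbitrary Hilbert space is cut down to the range
    of its first factor. An orthonormal basis of this range turns the first
    factor into a family in E1, whose bound is checked against the polar of
    P1. *)
Lemma norms_factorable z (r rho : R) : 0 < rho -> r < rho ->
  factorization_norms (gauge_norm P1) (gauge_norm P2) z r -> hfac (rho^-1 *: z).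
Proof.
move=> rho0 rrho [H [S [T [bS bT ST rE]]]].
set s := opnorm _ _ S in rE; set t := opnorm _ _ T in rE.
have s0 : 0 <= s by exact: opnorm_ge0.
have t0 : 0 <= t by apply: opnorm_ge0; exact: gauge_ge0.
(* Rescaling by sg moves the whole constant to the second factor; the case
   t = 0 leaves sg free. *)
have [sg [sg0 ssg tsg]] : exists sg, [/\ 0 < sg, s <= sg & t * sg <= rho].
  have [tz|tz] := eqVneq t 0.
    by exists (s + 1); rewrite ltr_wpDl// lerDl ler01 tz mul0r ltW.
  have tp : 0 < t by rewrite lt_neqAle eq_sym tz.
  exists (rho / t); rewrite divr_gt0// ler_pdivlMr// mulrC -rE ltW//.
  by rewrite mulrCA divff// mulr1.
have [n [h [hh hX]]] := gram_schmidt [seq S (dual_coord i) | i : 'I_(\dim {:E1})].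
have SdE i : S (dual_coord i) = \sum_k inner (S (dual_coord i)) (h k) *: h k.
  by apply: hX; apply/fintype.imageP; exists i.
have phiE (phi : 'Hom(E1, R^o)) :
    phi = \sum_(i < \dim {:E1}) (phi (vbasis {:E1})`_i : R) *: dual_coord i.
  apply/lfunP => x; rewrite [in LHS](coord_vbasis (memvf x)) linear_sum sum_lfunE.
  apply: eq_bigr => i _; rewrite linearZ/= scale_lfunE dual_coordE.
  by rewrite /GRing.scale/= mulrC.
have SE phi : S phi = \sum_k inner (S phi) (h k) *: h k.
  rewrite (phiE phi) linear_sum.
  under [RHS]eq_bigr do rewrite inner_suml scaler_suml.
  rewrite exchange_big/=; apply: eq_bigr => i _.
  rewrite linearZ/= {1}SdE scaler_sumr.
  by apply: eq_bigr => k _; rewrite innerZl scalerA.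
pose a k := \sum_(i < \dim {:E1}) inner (S (dual_coord i)) (h k) *: (vbasis {:E1})`_i.
have aE (psi : 'Hom(E1, R^o)) (k : 'I_n) : psi (a k) = inner (S psi) (h k) :> R.
  rewrite linear_sum [in RHS](phiE psi) linear_sum inner_suml.
  by apply: eq_bigr => i _; rewrite linearZ/= linearZ/= innerZl /GRing.scale/= mulrC.
have zE : z = \sum_k tens (a k) (T (h k)).
  apply: tensor_op_inj => phi; rewrite ST/= tensor_op_sum_tens SE linear_sum.
  by apply: eq_bigr => k _; rewrite linearZ aE.
have hc (c : l2 R n) : `|c| <= 1 -> `|\sum_k c ord0 k *: h k| <= 1.
  move=> c1; apply: le_trans c1; rewrite -(@ler_pXn2r _ 2) ?nnegrE//.
  rewrite l2_norm_sqr -inner_normr inner_suml ler_sum// => j _.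
  rewrite innerZl inner_sumr (bigD1 j)//= big1 ?addr0.
    by rewrite innerZr hh eqxx mulr1 expr2.
  by move=> k kj; rewrite innerZr hh eq_sym (negbTE kj) mulr0.
exists n, (fun k => sg^-1 *: a k), (fun k => (sg / rho) *: T (h k)); split.
- rewrite zE scaler_sumr; apply: eq_bigr => k _.
  by rewrite tensZl tensZr scalerA mulrA mulVf ?mul1r// gt_eqF.
- move=> c c1; apply: (bipolar bP1) => y Py.
  pose phi : 'Hom(E1, R^o) := linfun (fun x : E1 => inner x y : R^o).
  have phiy x : phi x = inner x y.
    pose L := HB.pack_for {linear E1 -> R^o} (fun x : E1 => inner x y : R^o)
      (GRing.isLinear.Build _ _ _ _ (fun x : E1 => inner x y : R^o)
        (fun k u v => etrans (innerDl _ _ _) (congr1 (+%R^~ _) (innerZl k u y)))).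
    exact: (lfunE L).
  have phi1 : dual_norm (gauge_norm P1) phi <= 1.
    have phi_le x : gauge_norm P1 x <= 1 -> `|phi x : R^o| <= 1.
      by move=> /(gauge_le1 bP1) Px; rewrite phiy; exact: polar_body_le Px Py.
    exact: (opnorm_le ler01 phi_le).2.
  rewrite -phiy /l2_comb linear_sum.
  have -> : \sum_k phi (c ord0 k *: (sg^-1 *: a k)) =
      sg^-1 * inner (S phi) (\sum_k c ord0 k *: h k).
    rewrite inner_sumr mulr_sumr; apply: eq_bigr => k _.
    by rewrite !linearZ/= aE innerZr mulrCA.
  rewrite mulrC ler_pdivrMr// mul1r; apply: le_trans ssg.
  rewrite (le_trans (inner_le_norm _ _))//.
  by rewrite -[leRHS]mulr1 ler_pM ?hc//; exact: le_opnorm.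
- move=> c c1; set v := \sum_k c ord0 k *: h k.
  have -> : l2_comb (fun k => (sg / rho) *: T (h k)) c = (rho / sg)^-1 *: T v.
    rewrite linear_sum /l2_comb scaler_sumr; apply: eq_bigr => k _.
    by rewrite [T (_ *: _)]linearZ/= !scalerA invf_div mulrC.
  apply/gauge_le => //; first by rewrite divr_gt0.
  apply: le_trans (_ : t <= _); first by apply: le_opnorm => //; exact: hc.
  by rewrite ler_pdivlMr.
Qed.

(** The unit ball of omega2 in terms of finite families. The limit t -> 1
    replaces a proof that the infimum in omega2 is attained. *)
Lemma w2tensP z :
  w2tens P1 P2 z <-> forall t : R, 0 < t -> t < 1 -> hfac (t *: z).
Proof.
split=> [z1 t t0 t1|Hz].
  have [u u0 uz] := factorable_absorbing bP1 bP2 z.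
  have [||r rz rt] :=
    @inf_lt _ (factorization_norms (gauge_norm P1) (gauge_norm P2) z) t^-1.
  - have ui : 0 < u^-1 by rewrite invr_gt0.
    have uf : hfac (u^-1^-1 *: z) by rewrite invrK.
    by have [r rz _] := factorable_norms ui uf; exists r.
  - by apply: le_lt_trans z1 _; rewrite invf_gt1.
  - by rewrite -[t]invrK; apply: norms_factorable rt rz; rewrite invr_gt0.
apply/ler_addgt0Pr => e e0.
have e1 : 0 < 1 + e by rewrite addr_gt0.
have ez : hfac ((1 + e)^-1 *: z).
  by apply: Hz; rewrite ?invr_gt0// invf_lt1// ltrDl.
have [r rz re] := factorable_norms e1 ez.
apply: le_trans re; apply: ge_inf => //; exists 0 => s.
by apply: factorization_norms_ge0; exact: gauge_ge0.
Qed.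

End TwoBodies.
End OmegaTwo.

(** * The Hilbertian tensor product is an injective tensor product *)

Section SubspaceBody.
Context (R : realType) (E : euclidType R).

Lemma inner_vsval (M : {vspace E}) (x y : subvs_of M) :
  inner (vsval x) (vsval y) = inner x y.
Proof. by []. Qed.

Lemma norm_vsval (M : {vspace E}) (x : subvs_of M) : `|vsval x| = `|x|.
Proof.
by apply/eqP; rewrite -(@eqrXn2 _ 2)// -!inner_normr inner_vsval.
Qed.

Lemma subspace_body (M : {vspace E}) (P : set E) : sym_convex_body P ->
  sym_convex_body (@vsval R E M @^-1` P).
Proof.
move=> bP; apply/sym_convex_bodyP; split.
- apply: closed_of_approx => x xP; apply: (closed_approx (body_closed bP)) => e e0.
  have [y Py xy] := xP e e0; exists (vsval y) => //.
  by rewrite -linearB norm_vsval.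
- have [m m0 Pm] := body_bounded bP; exists m => x /Pm; by rewrite norm_vsval.
- move=> x y a b Px Py ab; change (P (vsval (a *: x + b *: y))).
  have -> : vsval (a *: x + b *: y) = a *: vsval x + b *: vsval y.
    by rewrite linearD !linearZ.
  exact: (body_abs_convex bP).
- have [e e0 Pe] := body_ball bP; exists e => // x xe.
  by apply: Pe; rewrite norm_vsval.
Qed.

Lemma weakly_bounded (C : set E) :
  (forall y, exists m : R, forall z, C z -> `|inner z y| <= m) ->
  exists m : R, forall z, C z -> `|z| <= m.
Proof.
move=> Cb; have [s sE] := orthonormal_expansion_full E.
have [m Cm] := choice Cb.
exists (\sum_(g <- s) m g * `|g|) => z Cz; rewrite (sE z).
rewrite (le_trans (ler_norm_sum _ _ _))// ler_sum// => g _.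
by rewrite normrZ ler_wpM2r// Cm.
Qed.

End SubspaceBody.

Section HilbertianTensorProduct.
Context (R : realType).

Section TwoBodies.
Context (E1 E2 : euclidType R) (P1 : set E1) (P2 : set E2).
Context (bP1 : sym_convex_body P1) (bP2 : sym_convex_body P2).
Local Notation hfac := (hilbert_factorable P1 P2).

Lemma factorable_w2tens z : hfac z -> w2tens P1 P2 z.
Proof.
move=> hz; apply/(w2tensP bP1 bP2) => t t0 t1.
apply: abs_convexZ => //; first exact: factorable_abs_convex.
by rewrite gtr0_norm// ltW.
Qed.

Lemma w2tens_abs_convex : abs_convex (w2tens P1 P2).
Proof.
move=> z w s t /(w2tensP bP1 bP2) hz /(w2tensP bP1 bP2) hw st.
apply/(w2tensP bP1 bP2) => r r0 r1.
rewrite scalerDr !scalerA mulrC (mulrC r) -!scalerA.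
by apply: factorable_abs_convex => //; [exact: hz|exact: hw].
Qed.

Lemma w2tens_polar z y1 y2 : w2tens P1 P2 z -> polar P1 y1 -> polar P2 y2 ->
  inner z (tens y1 y2) <= 1.
Proof.
move=> /(w2tensP bP1 bP2) hz Py1 Py2; rewrite leNgt; apply/negP => zy.
have q0 : 0 < inner z (tens y1 y2) by apply: lt_trans zy.
have i0 : 0 < (inner z (tens y1 y2))^-1 by rewrite invr_gt0.
have i1 : (inner z (tens y1 y2))^-1 < 1 by rewrite invf_lt1.
have [t it t1] : exists2 t, (inner z (tens y1 y2))^-1 < t & t < 1.
  by exists ((1 + (inner z (tens y1 y2))^-1) / 2); lra.
have := factorable_polar bP1 bP2 (hz t (lt_trans i0 it) t1) Py1 Py2.
by rewrite innerZl leNgt -ltr_pdivrMr// mul1r it.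
Qed.

(** Boundedness is tested on elementary tensors, through the polars; closedness
    holds because a small perturbation of z is absorbed, after shrinking, by a
    ball inside the set of factorable tensors. *)
Lemma w2tens_body : sym_convex_body (w2tens P1 P2).
Proof.
have aP := factorable_abs_convex bP1 bP2.
have [e e0 He] := absorbing_ball aP (factorable_absorbing bP1 bP2).
apply/sym_convex_bodyP; split.
- apply: closed_of_approx => x xW; apply/(w2tensP bP1 bP2) => t t0 t1.
  pose s := (1 + t) / 2.
  have [s0 ts s1] : [/\ 0 < s, t < s & s < 1] by rewrite /s; split; lra.
  have ts1 : 0 < 1 - t / s by rewrite subr_gt0 ltr_pdivrMr// mul1r.
  have [y /(w2tensP bP1 bP2) yW xy] := xW (e * (1 - t / s)) (mulr_gt0 e0 ts1).
  have -> : t *: x = (t / s) *: (s *: y) +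
      (1 - t / s) *: ((1 - t / s)^-1 *: (t *: (x - y))).
    rewrite !scalerA divfK ?gt_eqF// divff ?gt_eqF// mul1r.
    by rewrite scalerBr addrCA subrr addr0.
  apply: aP; first exact: yW.
    apply: He; rewrite normrZ gtr0_norm ?invr_gt0// normrZ gtr0_norm//.
    rewrite mulrC ler_pdivrMr//; apply: le_trans (ltW xy).
    by rewrite ler_piMl// ltW.
  by rewrite !gtr0_norm ?divr_gt0//; lra.
- apply: weakly_bounded => w; have [n [x [y ->]]] := tensor_decomp w.
  elim/big_ind : _ => [|u v [a ua] [b vb]|k _].
  + by exists 0 => z _; rewrite inner0r normr0.
  + exists (a + b) => z Wz; rewrite innerDr (le_trans (ler_normD _ _))//.
    by rewrite lerD ?ua ?vb.
  + have [s s0 Ps] := polar_absorbing bP1 (x k).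
    have [t t0 Pt] := polar_absorbing bP2 (y k).
    exists (s * t)^-1 => z Wz.
    have h v : w2tens P1 P2 v -> inner v (tens (x k) (y k)) <= (s * t)^-1.
      move=> Wv; rewrite -[leRHS]mul1r ler_pdivlMr ?mulr_gt0// mulrC -innerZr.
      by rewrite -scalerA -tensZr -tensZl; apply: w2tens_polar.
    rewrite ler_norml h// andbT lerNl -mulN1r -innerZl; apply: h.
    by apply: abs_convexZ => //; [exact: w2tens_abs_convex|rewrite normrN1].
- exact: w2tens_abs_convex.
- by exists e => // x /He; exact: factorable_w2tens.
Qed.

End TwoBodies.

Lemma w2tens_map (E1 E2 F1 F2 : euclidType R)
    (T1 : {linear E1 -> F1}) (T2 : {linear E2 -> F2})
    (P1 : set E1) (P2 : set E2) (Q1 : set F1) (Q2 : set F2) z :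
  sym_convex_body P1 -> sym_convex_body P2 ->
  sym_convex_body Q1 -> sym_convex_body Q2 ->
  (forall x, P1 x -> Q1 (T1 x)) -> (forall x, P2 x -> Q2 (T2 x)) ->
  w2tens P1 P2 z -> w2tens Q1 Q2 (tmap T1 T2 z).
Proof.
move=> bP1 bP2 bQ1 bQ2 PQ1 PQ2 /(w2tensP bP1 bP2) hz.
apply/(w2tensP bQ1 bQ2) => t t0 t1; rewrite -tmapZ.
exact: factorable_map PQ1 PQ2 (hz t t0 t1).
Qed.

Lemma w2tens_tensor_product : is_tensor_product (@w2tens R).
Proof.
split.
- by move=> E1 E2 P1 P2; exact: w2tens_body.
- move=> E1 E2 P1 P2 bP1 bP2; apply: smallest_sub.
    exact/abs_convex_set/w2tens_abs_convex.
  by move=> _ [x Px [y Py <-]]; apply: factorable_w2tens => //; exact: factorable_tens.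
- move=> E1 E2 P1 P2 bP1 bP2 z Wz.
  suff sub : ptens (polar P1) (polar P2) `<=` [set w | inner w z <= 1] by move=> w /sub.
  apply: smallest_sub => [|_ [x Px [y Py <-]]]; last first.
    by rewrite /= innerC; exact: w2tens_polar Wz Px Py.
  apply/convex_setP => u v t /= uz vz t0 t1.
  by rewrite innerDl !innerZl; nra.
- move=> E1 E2 F1 F2 T1 T2 P1 P2 Q1 Q2 bP1 bP2 bQ1 bQ2 PQ1 PQ2 _ [z Wz <-].
  apply: w2tens_map Wz => // x Px; [apply: PQ1|apply: PQ2]; by exists x.
Qed.

(** One inclusion is the metric mapping property for the inclusion maps; the
    other one is the projection argument of [factorable_subspace]. *)
Lemma w2tens_injective : injective_tensor (@w2tens R).
Proof.
move=> E1 E2 P1 P2 M1 M2 bP1 bP2 incl.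
have bM1 := subspace_body M1 bP1; have bM2 := subspace_body M2 bP2.
apply/seteqP; split => [_ [z Wz <-]|u [Wz [z _ zE]]].
  by split; [apply: (w2tens_map bM1 bM2 bP1 bP2 _ _ Wz)|exists z].
exists z => //; apply/(w2tensP bM1 bM2) => t t0 t1.
apply: factorable_subspace; rewrite tmapZ -/incl zE.
by move/(w2tensP bP1 bP2) : Wz; apply.
Qed.

End HilbertianTensorProduct.

(** * Cubes, the Grothendieck constant and injective tensor products *)

Section Cube.
Context (R : realType) (m : nat).

Definition cube : set (l2 R m) := [set c | forall i, `|c ord0 i| <= 1].

Lemma cube_body : sym_convex_body cube.
Proof.
apply/sym_convex_bodyP; split.
- apply: closed_of_approx => c cQ i; apply/ler_addgt0Pr => e e0.
  have [d dQ cd] := cQ e e0.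
  rewrite -(subrK (d ord0 i) (c ord0 i)) (le_trans (ler_normD _ _))// addrC.
  rewrite lerD ?dQ//; apply: le_trans (ltW cd); apply: le_trans (l2_coord_le _ i).
  by rewrite !mxE.
- exists (1 + m%:R) => c cQ; rewrite -(@ler_pXn2r _ 2) ?nnegrE ?addr_ge0//.
  apply: le_trans (_ : m%:R <= _).
    rewrite l2_norm_sqr; apply: le_trans (_ : \sum_(i < m) 1 <= _).
      apply: ler_sum => i _; rewrite -real_normK ?num_real//.
      by rewrite expr_le1// cQ.
    by rewrite sumr_const card_ord.
  by have := ler0n R m; nra.
- move=> c d a b cQ dQ ab i; rewrite !mxE (le_trans (ler_normD _ _))//.
  apply: le_trans ab; rewrite !normrM.
  by rewrite lerD// ler_piMr// ?cQ ?dQ.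
- by exists 1 => // c c1 i; apply: le_trans (l2_coord_le c i) c1.
Qed.

Lemma max_norm_cube (c : 'rV[R]_m) : `|c| <= 1 <-> cube c.
Proof.
rewrite [`|c|]/Num.norm/= mx_normrE; split=> [c1 i|cQ].
  by apply: le_trans c1; apply/bigmax_geP; right; exists (ord0, i).
by apply/bigmax_leP; split=> // -[i j] _ /=; rewrite (ord1 i); exact: cQ.
Qed.

Lemma max_norm_functional_bounded (phi : 'Hom('rV[R]_m, R^o)) :
  bounded_op (@Num.norm R 'rV[R]_m) (@Num.norm R R^o) phi.
Proof.
have [M _ QM] := body_bounded cube_body.
have [C C0 pC] := linear_bounded (fun_of_lfun phi : {linear l2 R m -> R^o}).
exists (C * M) => _ [c /max_norm_cube/QM cM <-].
by rewrite (le_trans (pC c))// ler_pM2l.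
Qed.

End Cube.

(** Polyhedral model of a body: up to the factor t, a body is a section of a
    cube. The constraints of an outer polytope are the coordinates of J, and L is
    t times the inverse of J on its range. *)
Lemma cube_section (R : realType) (E : euclidType R) (P : set E) (t : R) :
  sym_convex_body P -> 0 < t -> t < 1 ->
  exists m (J : {linear E -> l2 R m}) (M : {vspace l2 R m})
      (L : {linear subvs_of M -> E}),
    [/\ forall x, P x -> cube (J x), forall x, J x \in M,
        forall v, cube (vsval v) -> P (L v)
      & forall x, L (vsproj M (J x)) = t *: x].
Proof.
move=> bP t0 t1; have [m [y [Py yP]]] := polytope_approx bP t0 t1.
pose j (x : E) : l2 R m := \row_i inner x (y i).
have jlin : linear j.
  by move=> a u v; apply/rowP => i; rewrite !mxE innerDl innerZl.
pose J := HB.pack_for {linear E -> l2 R m} j (GRing.isLinear.Build _ _ _ _ j jlin).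
pose Jh : 'Hom(E, l2 R m) := linfun J.
have JhE x : Jh x = j x by exact: (lfunE J).
have ker : lker Jh == 0%VS.
  apply/lker0P => x x' xx'; apply/eqP; rewrite -subr_eq0; apply/eqP.
  have : Jh (x - x') = 0 by rewrite linearB/= xx' subrr.
  move: (x - x') => d Jd.
  have [M M0 PM] := body_bounded bP.
  have dM (r : R) : 0 < r -> t * r * `|d| <= M.
    move=> r0; have /yP/PM : forall i, `|inner (r *: d) (y i)| <= 1.
      move=> i; rewrite innerZl.
      have -> : inner d (y i) = 0.
        by have := JhE d; rewrite Jd => /rowP/(_ i); rewrite !mxE.
      by rewrite mulr0 normr0.
    by rewrite !normrZ !gtr0_norm// mulrA.
  apply: contrapT => /eqP d0; have nd : 0 < `|d| by rewrite normr_gt0.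
  have td : 0 < t * `|d| by rewrite mulr_gt0.
  have := dM ((M + 1) / (t * `|d|)).
  rewrite divr_gt0 ?addr_gt0// mulrAC mulrCA divff ?gt_eqF// mulr1 => /(_ isT).
  by lra.
pose l (v : subvs_of (limg Jh)) : E := t *: (Jh^-1%VF (vsval v)).
have llin : linear l.
  move=> a u v; rewrite /l.
  have -> : Jh^-1%VF (vsval (a *: u + v)) = a *: Jh^-1%VF (vsval u) + Jh^-1%VF (vsval v).
    by rewrite !linearP.
  by rewrite scalerDr !scalerA mulrC.
pose L := HB.pack_for {linear subvs_of (limg Jh) -> E} l
  (GRing.isLinear.Build _ _ _ _ l llin).
have JM x : j x \in limg Jh by rewrite -JhE memv_img// memvf.
exists m, J, (limg Jh), L; split=> //.
- by move=> x Px i; rewrite mxE; apply: polar_body_le (Py i).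
- move=> v; have /memv_imgP[x _ vx] := subvsP v; rewrite /L/= /l vx.
  rewrite lker0_lfunK// => xQ; apply: yP => i.
  by have := xQ i; rewrite JhE mxE.
- by move=> x; rewrite /L/= /l vsprojK// -[X in Jh^-1%VF X]JhE lker0_lfunK.
Qed.

Section FactorableSubInjective.
Context (R : realType).
Local Notation maxnorm n := (@Num.norm R 'rV[R]_n).

(** A tensor of projective norm less than K is a convex combination of multiples
    by K of elementary tensors of the two unit balls. *)
Lemma pi_norm_lt_cube m n (u : tensor (l2 R m) (l2 R n)) (K : R)
    (B : set (tensor (l2 R m) (l2 R n))) :
  abs_convex B -> (forall c d, cube c -> cube d -> B (tens c d)) ->
  pi_norm (maxnorm m) (maxnorm n) u < K -> B (K^-1 *: u).
Proof.
move=> aB BQ uK.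
have [N0 [x0 [y0 uE0]]] := @tensor_decomp _ 'rV[R]_m 'rV[R]_n u.
have ne : [set r | exists N (x : 'I_N -> 'rV[R]_m) (y : 'I_N -> 'rV[R]_n),
    u = \sum_k tens (x k) (y k) /\ r = \sum_k `|x k| * `|y k|] !=set0.
  by exists (\sum_k `|x0 k| * `|y0 k|), N0, x0, y0.
have [r [N [x [y [uE rE]]]] rK] := inf_lt ne uK.
have r0 : 0 <= r by rewrite rE sumr_ge0.
have K0 : 0 < K by apply: le_lt_trans rK.
have unit_cube k (v : 'rV[R]_k) : cube (`|v|^-1 *: v).
  apply/max_norm_cube; rewrite normrZ normfV normr_id.
  have [->|v0] := eqVneq v 0; first by rewrite normr0 mulr0.
  by rewrite mulVf// normr_eq0.
have norm_unit k (v : 'rV[R]_k) : `|v| *: (`|v|^-1 *: v) = v.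
  have [->|v0] := eqVneq v 0; first by rewrite !scaler0.
  by rewrite scalerA divff ?scale1r// normr_eq0.
have -> : K^-1 *: u = \sum_k (K^-1 * (`|x k| * `|y k|)) *:
    (tens (`|x k|^-1 *: x k : l2 R m) (`|y k|^-1 *: y k : l2 R n)).
  rewrite uE scaler_sumr; apply: eq_bigr => k _; rewrite -scalerA; congr (_ *: _).
  by rewrite -scalerA -tensZr -tensZl !norm_unit.
apply: abs_convex_sum => //.
- by rewrite -(tens0l _ 0); apply: BQ; exact: body0 (cube_body _ _).
- by move=> k; apply: BQ; exact: unit_cube.
under eq_bigr do rewrite normrM !normrM !normr_id normfV (gtr0_norm K0).
by rewrite -mulr_sumr -rE mulrC ler_pdivrMr// mul1r ltW.
Qed.

Lemma omega2_max_norm_le1 m n (u : tensor (l2 R m) (l2 R n)) :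
  hilbert_factorable (@cube R m) (@cube R n) u ->
  omega2 (maxnorm m) (maxnorm n) u <= 1.
Proof.
move=> [N [a [b [-> aQ bQ]]]].
apply: (@omega2_le_families R 'rV[R]_m 'rV[R]_n) => //.
- exact: max_norm_functional_bounded.
- by move=> c /aQ Qc; apply/max_norm_cube.
- by move=> c /bQ Qc; apply/max_norm_cube.
Qed.

(** The factorization is transported to a pair of cubes, where the assumed
    comparison with the projective norm applies; injectivity brings the estimate
    back to the sections of the cubes that approximate the given bodies. *)
Lemma factorable_sub_injective (beta : body_operation R) (K : R)
    (E1 E2 : euclidType R) (P1 : set E1) (P2 : set E2) z :
  is_tensor_product beta -> injective_tensor beta ->
  sym_convex_body P1 -> sym_convex_body P2 ->
  (forall m n (u : tensor 'rV[R]_m 'rV[R]_n),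
     omega2 (maxnorm m) (maxnorm n) u <= 1 ->
     pi_norm (maxnorm m) (maxnorm n) u < K) ->
  hilbert_factorable P1 P2 z -> beta E1 E2 P1 P2 (K^-1 *: z).
Proof.
move=> tb ib bP1 bP2 HK hz; have bb := tensor_body tb bP1 bP2.
(* Each of the two cube sections costs a factor t, hence t = sqrt r. *)
apply: (body_radially_closed bb) => r r0 r1; pose t := Num.sqrt r.
have t0 : 0 < t by rewrite sqrtr_gt0.
have t1 : t < 1 by rewrite -sqrtr1 ltr_sqrt.
have tt : t * t = r by rewrite -expr2 sqr_sqrtr// ltW.
have [m [J1 [M1 [L1 [PQ1 JM1 QP1 LJ1]]]]] := cube_section bP1 t0 t1.
have [n [J2 [M2 [L2 [PQ2 JM2 QP2 LJ2]]]]] := cube_section bP2 t0 t1.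
have bQ1 := cube_body R m; have bQ2 := cube_body R n.
have bQM1 := subspace_body M1 bQ1; have bQM2 := subspace_body M2 bQ2.
pose u := tmap J1 J2 z.
have hu : hilbert_factorable (@cube R m) (@cube R n) u by exact: factorable_map hz.
have uB : beta _ _ (@cube R m) (@cube R n) (K^-1 *: u).
  apply: pi_norm_lt_cube.
  - exact: body_abs_convex (tensor_body tb bQ1 bQ2).
  - move=> c d Qc Qd; apply: (tensor_ge_pi tb bQ1 bQ2) => C [_]; apply.
    by exists c => //; exists d.
  - by apply: HK; exact: omega2_max_norm_le1.
pose w := K^-1 *: tmap (vsproj M1 \o J1) (vsproj M2 \o J2) z.
have wE : tmap vsval vsval w = K^-1 *: u.
  by rewrite /w tmapZ tmap_subspace_corestrict.
have : (beta _ _ (@cube R m) (@cube R n) `&`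
    range (tmap (@vsval R _ M1) (@vsval R _ M2))) (K^-1 *: u) by split => //; exists w.
rewrite -(ib _ _ _ _ M1 M2 bQ1 bQ2) => -[w' Bw' w'E].
have {w'E} w'w : w' = w by apply: tmap_subspace_inj; rewrite w'E wE.
have -> : r *: (K^-1 *: z) = tmap L1 L2 w.
  rewrite /w tmapZ tmap_comp (@tmap_scale _ _ _ _ _ t t).
  - by rewrite tt !scalerA mulrC.
  - exact: LJ1.
  - exact: LJ2.
apply: (tensor_map tb bQM1 bQM2 bP1 bP2 (T1 := L1) (T2 := L2)).
- by move=> _ [v Qv <-]; exact: QP1.
- by move=> _ [v Qv <-]; exact: QP2.
- by exists w => //; rewrite -w'w.
Qed.

(** K_G is an infimum; when the set of admissible constants has none, its value
    is 0 by convention. *)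
Lemma K_G_bound : K_G R = 0 \/ forall m n (u : tensor 'rV[R]_m 'rV[R]_n),
  omega2 (maxnorm m) (maxnorm n) u <= 1 ->
  pi_norm (maxnorm m) (maxnorm n) u <= `|K_G R|.
Proof.
have [hi|hi] := pselect (has_inf [set K | forall m n (u : tensor 'rV[R]_m 'rV[R]_n),
    pi_norm (maxnorm m) (maxnorm n) u <= K * omega2 (maxnorm m) (maxnorm n) u]);
  last by left; rewrite /K_G inf_out.
right=> m n u u1; apply/ler_addgt0Pr => e e0.
have [K KP Ke] := inf_adherent e0 hi.
have w0 : 0 <= omega2 (maxnorm m) (maxnorm n) u.
  have [ne|/nonemptyPn e_] :=
      pselect (factorization_norms (maxnorm m) (maxnorm n) u !=set0).
    by apply: lb_le_inf => // s; apply: factorization_norms_ge0.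
  by rewrite /omega2 -/(factorization_norms _ _ u) e_ inf0.
apply: le_trans (KP m n u) _.
have {}Ke : K <= `|K_G R| + e.
  by apply: le_trans (ltW Ke) _; rewrite lerD2r ler_norm.
apply: le_trans (_ : (`|K_G R| + e) * omega2 (maxnorm m) (maxnorm n) u <= _).
  exact: ler_wpM2r.
by rewrite ler_piMr// addr_ge0// ltW.
Qed.

End FactorableSubInjective.

Theorem proposition4p2 (R : realType) (E1 E2 : euclidType R)
    (P1 : set E1) (P2 : set E2) :
  sym_convex_body P1 -> sym_convex_body P2 ->
  [set (K_G R)^-1 *: z | z in w2tens P1 P2] `<=` pi_inj P1 P2 /\
  pi_inj P1 P2 `<=` w2tens P1 P2.
Proof.
move=> bP1 bP2; split=> [_ [z Wz <-] beta tb ib _|z Hz]; last first.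
  apply: Hz; [exact: w2tens_tensor_product|exact: w2tens_injective|].
  exact: tensor_ge_pi (w2tens_tensor_product R).
have bb := tensor_body tb bP1 bP2.
have [->|K0] := eqVneq (K_G R) 0; first by rewrite invr0 scale0r; exact: body0.
have [/eqP|KP] := K_G_bound R; first by rewrite (negbTE K0).
have nK : 0 < `|K_G R| by rewrite normr_gt0.
suff Hb : beta E1 E2 P1 P2 (`|K_G R|^-1 *: z).
  have -> : (K_G R)^-1 *: z = Num.sg (K_G R) *: (`|K_G R|^-1 *: z).
    by rewrite scalerA {1}[K_G R]numEsg invfM invr_sg.
  by apply: (bodyZ bb) => //; rewrite normr_sg; case: (_ != _).
(* One factor t makes the tensor factorable, the other makes the constant
   strictly larger than |K_G|. *)
apply: (body_radially_closed bb) => r r0 r1; pose t := Num.sqrt r.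
have t0 : 0 < t by rewrite sqrtr_gt0.
have t1 : t < 1 by rewrite -sqrtr1 ltr_sqrt.
have tt : t * t = r by rewrite -expr2 sqr_sqrtr// ltW.
have -> : r *: (`|K_G R|^-1 *: z) = (`|K_G R| / t)^-1 *: (t *: z).
  by rewrite !scalerA invf_div -tt; congr (_ *: _); rewrite mulrAC.
apply: factorable_sub_injective => // [m n u /KP pu|].
  by apply: le_lt_trans pu _; rewrite ltr_pdivlMr// gtr_pMr.
by move/(w2tensP bP1 bP2) : Wz; apply.
Qed.
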